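(* Let $\Omega\subset\mathbb{R}^n$ be open, $n\ge 1$. Assume that $\varphi\in\Phi_{\mathrm w}(\Omega)$ satisfies (A0), (A1), (A2) and (aInc)$^\infty$. Assume that there exists a measurable set $G\subset\Omega$ with $0\le |G|<\infty$ such that $\varphi$ satisfies (aInc)$_p$ for some $p>1$ on $\Omega\setminus G$ (that is, on $(\Omega\setminus G)\times(0,\infty)$). Then the maximal operator $M: L^\varphi(\Omega)\to L^\varphi(\Omega)$ is bounded, i.e. there is a constant $K$ such that $\|Mf\|_{L^\varphi(\Omega)}\le K\|f\|_{L^\varphi(\Omega)}$ for all $f\in L^\varphi(\Omega)$.
   Context: $|A|$ denotes Lebesgue measure. A function $f$ is $L$-almost increasing ($L\ge1$) if $f(s)\le L f(t)$ for all $s<t$. Weak $\Phi$-functions: $\varphi:\Omega\times[0,\infty)\to[0,\infty]$ belongs to $\Phi_{\mathrm w}(\Omega)$ if: (i) for every measurable $f:\Omega\to\mathbb{R}$ the function $x\mapsto\varphi(x,|f(x)|)$ is measurable, and for every $x\in\Omega$ the function $t\mapsto\varphi(x,t)$ is non-decreasing; (ii) $\varphi(x,0)=\lim_{t\to0^+}\varphi(x,t)=0$ and $\lim_{t\to\infty}\varphi(x,t)=\infty$ for every $x\in\Omega$; (iii) $t\mapsto\varphi(x,t)/t$ is $L$-almost increasing on $(0,\infty)$ with $L$ independent of $x$. If $\varphi$ does not depend on $x$ we write $\varphi\in\Phi_{\mathrm w}$. Generalized inverse: $\varphi^{-1}(x,t):=\inf\{\tau\ge0:\varphi(x,\tau)\ge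 t\}$. (aInc)$_p$ on $A\times T$ ($A\subset\Omega$, $T\subset[0,\infty)$): there is $a\ge1$ with $\frac{\varphi(x,t)}{t^p}\le a\frac{\varphi(x,s)}{s^p}$ for all $t,s\in T$ with $0<t<s$ and almost all $x\in A$. (aInc)$^\infty$: there exist $p>1$ and $t_0>0$ such that $\varphi$ satisfies (aInc)$_p$ on $\Omega\times[t_0,\infty)$. (A0): there exists $\beta\in(0,1]$ such that $\beta\le\varphi^{-1}(x,1)\le\frac1\beta$ for almost every $x\in\Omega$. (A1): there exists $\beta\in(0,1)$ such that $\beta\varphi^{-1}(x,t)\le\varphi^{-1}(y,t)$ for every $t\in[1,\frac1{|B|}]$, almost every $x,y\in B\cap\Omega$ and every ball $B$ with $|B|\le1$. (A2): there exist $\varphi_\infty\in\Phi_{\mathrm w}$, $h\in L^1(\Omega)\cap L^\infty(\Omega)$, $\beta\in(0,1]$ and $s>0$ such that, for almost every $x\in\Omega$, $\varphi(x,\beta t)\le\varphi_\infty(t)+h(x)$ whenever $\varphi_\infty(t)\in[0,s]$, and $\varphi_\infty(\beta t)\le\varphi(x,t)+h(x)$ whenever $\varphi(x,t)\in[0,s]$. Generalized Orlicz space: $L^\varphi(\Omega)$ is the set of measurable $f$ with $\int_\Omega\varphi(x,\lambda|f(x)|)\,dx<\infty$ for some $\lambda>0$, with the quasinorm $\|f\|_{L^\varphi(\Omega)}=\inf\{\lambda>0:\int_\Omega\varphi(x,|f(x)|/\lambda)\,dx\le1\}$. Maximal function: $Mf(x)=\sup_B\frac1{|B|}\int_{B\cap\Omega}|f(y)|\,dy$,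 the supremum being over all open balls $B\subset\mathbb{R}^n$ containing $x$. *)

(* Defs.v *)
From HB Require Import structures.
From mathcomp Require Import all_boot all_order all_algebra.
From mathcomp Require Import all_classical all_reals all_analysis.
From mathcomp Require Import measurable_realfun ess_sup_inf.
Set Implicit Arguments.
Unset Strict Implicit.
Unset Printing Implicit Defensive.
Import Order.TTheory GRing.Theory Num.Theory.
Import numFieldNormedType.Exports.

Local Open Scope classical_set_scope.
Local Open Scope ring_scope.

(* [euclid R n] is R^(n+1), so that n : nat ranges over all dimensions >= 1. *)
Definition euclid (R : realType) (n : nat) := 'rV[R]_n.+1.

HB.instance Definition _ (R : realType) (n : nat) :=
  NormedModule.copy (euclid R n) 'rV[R]_n.+1.

Section lebesgue_outer_measure.
Context (R : realType) (n : nat).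
Implicit Types (a b x : euclid R n) (A : set (euclid R n)).
Local Open Scope ereal_scope.

Definition box a b : set (euclid R n) :=
  [set x | forall i, (a ord0 i < x ord0 i <= b ord0 i)%R].

Definition box_volume (ab : euclid R n * euclid R n) : \bar R :=
  (\prod_i (ab.2 ord0 i - ab.1 ord0 i))%:E.

Definition box_cover A : set (nat -> euclid R n * euclid R n) :=
  [set c : nat -> euclid R n * euclid R n | (forall k i, ((c k).1 ord0 i <= (c k).2 ord0 i)%R) /\
           A `<=` \bigcup_k box (c k).1 (c k).2].

Definition lebesgue_outer A : \bar R :=
  ereal_inf [set \sum_(k <oo) box_volume (c k) | c in box_cover A].

Lemma box_volume_ge0 (ab : euclid R n * euclid R n) :
  (forall i, (ab.1 ord0 i <= ab.2 ord0 i)%R) -> 0 <= box_volume ab.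
Proof. by move=> h; rewrite lee_fin; apply: prodr_ge0 => i _; rewrite subr_ge0. Qed.

Let outer0 : lebesgue_outer set0 = 0.
Proof.
apply/eqP; rewrite eq_le; apply/andP; split; last first.
  apply: le_ereal_inf_tmp => _ [c [cle _] <-].
  by apply: nneseries_ge0 => k _ _; apply: box_volume_ge0 => i; exact: cle.
apply: ereal_inf_lbound; exists (fun=> (0, 0)%R); first by split=> // x [].
apply: eseries0 => k _ _; rewrite /box_volume /= (bigD1 ord0) //=.
by rewrite subrr mul0r.
Qed.

Let outer_ge0 A : 0 <= lebesgue_outer A.
Proof.
apply: le_ereal_inf_tmp => _ [c [cle _] <-].
by apply: nneseries_ge0 => k _ _; apply: box_volume_ge0 => i; exact: cle.
Qed.

Let outer_le : {homo lebesgue_outer : A B / A `<=` B >-> A <= B}.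
Proof.
move=> A B AB; apply: ereal_inf_le_tmp => _ [c [cle Bc] <-].
by exists c => //; split=> //; exact: subset_trans AB Bc.
Qed.

Let outer_sigma_subadditive : sigma_subadditive lebesgue_outer.
Proof.
move=> A; have [[i ioo]|] := pselect (exists i, lebesgue_outer (A i) = +oo).
  by rewrite (eseries_pinfty _ _ ioo) ?leey// => k _;
    rewrite -ltNye (lt_le_trans _ (outer_ge0 _)).
rewrite -forallNE => Aoo.
apply/lee_addgt0Pr => _/posnumP[e].
apply: le_trans (epsilon_trick _ _ _); [|by move=> k; exact: outer_ge0|by []].
pose P k (c : nat -> euclid R n * euclid R n) := box_cover (A k) c /\
  \sum_(j <oo) box_volume (c j) <=
    lebesgue_outer (A k) + (e%:num / (2 ^ k.+1)%:R)%:E.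
have [G PG] : {G & forall k, P k (G k)}.
  apply: (@choice _ _ P) => k; rewrite /P /lebesgue_outer.
  set S := (X in ereal_inf X).
  have fS : ereal_inf S \is a fin_num.
    rewrite ge0_fin_numE; last exact: outer_ge0.
    by rewrite ltey; apply/eqP; exact: Aoo.
  have en1 : (0 < e%:num / (2 ^ k.+1)%:R :> R)%R by [].
  have [_ [c cA <-] clt] := lb_ereal_inf_adherent en1 fS.
  by exists c; split => //; exact: ltW.
have vG_ge0 (k : nat * nat) : 0 <= (box_volume \o uncurry G) k.
  by apply: box_volume_ge0 => i; case: k => k j; exact: (PG k).1.1.
apply: (@le_trans _ _ (\esum_(i in setT) (box_volume \o uncurry G) i)).
  apply: ereal_inf_lbound => /=.
  have /card_esym/ppcard_eqP[f] := card_nat2.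
  exists (uncurry G \o f).
    split => [k i /=|]; first by case: (f k) => l j; exact: (PG l).1.1.
    apply: (@subset_trans _ (\bigcup_k \bigcup_j box (G k j).1 (G k j).2)).
      by move=> t [i _] /((PG i).1.2) [j _ ?]; exists i => //; exists j.
    move=> t [i _ [j _ Bijt]]; exists (f^-1%FUN (i, j)) => //=.
    by rewrite invK ?inE.
  rewrite -(esum_pred_image (box_volume \o uncurry G) _ xpredT) ?[fun=> _]set_true//.
  by rewrite image_eq.
rewrite (_ : esum _ _ = \sum_(i <oo) \sum_(j <oo) box_volume (G i j)); last first.
  pose J : nat -> set (nat * nat) := fun i => [set (i, j) | j in setT].
  rewrite (_ : setT = \bigcup_k J k); last first.
    by rewrite predeqE => -[a b]; split => // _; exists a => //; exists b.
  rewrite esum_bigcupT /=; last 2 first.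
  - apply/trivIsetP => i j _ _ ij.
    rewrite predeqE => -[k m] /=; split => //= -[] [_] _ [<-{k} _].
    by move=> [m' _] [] /esym/eqP; rewrite (negbTE ij).
  - by move=> /= x; exact: vG_ge0.
  rewrite -(image_id [set: nat]) -fun_true esum_pred_image//; last first.
    by move=> k _; apply: esum_ge0 => j _; exact: vG_ge0.
  apply: eq_eseriesr => /= j _.
  rewrite -(esum_pred_image (box_volume \o uncurry G) (pair j) predT)//=; last 2 first.
  - by move=> k _; exact: (vG_ge0 (j, k)).
  - by move=> ? ? _ _; exact: (@can_inj _ _ _ snd).
  by congr esum; rewrite predeqE => -[a b]; split; move=> [i _ <-]; exists i.
apply: lee_nneseries => [k _ _|k _]; last by have [_] := PG k.
by apply: nneseries_ge0 => j _ _; exact: (vG_ge0 (k, j)).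
Qed.

HB.instance Definition _ := isOuterMeasure.Build R (euclid R n) lebesgue_outer
  outer0 outer_ge0 outer_le outer_sigma_subadditive.

End lebesgue_outer_measure.

(* The measurable sets of [euclid R n] are the Lebesgue measurable ones (and
   not only the Borel sets), through Caratheodory's criterion. *)
HB.instance Definition _ (R : realType) (n : nat) :=
  Measurable.copy (euclid R n) (caratheodory_type (@lebesgue_outer R n)).

Definition lebesgue (R : realType) (n : nat) : set (euclid R n) -> \bar R :=
  @lebesgue_outer R n.

HB.instance Definition _ (R : realType) (n : nat) :=
  isMeasure.Build _ (euclid R n) R (@lebesgue R n)
    (@caratheodory_measure0 _ _ (@lebesgue_outer R n))
    (@caratheodory_measure_ge0 _ _ (@lebesgue_outer R n))
    (@caratheodory_measure_sigma_additive _ _ (@lebesgue_outer R n)).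

Arguments lebesgue {R n}.

Section generalized_orlicz.
Context (R : realType) (n : nat).
Local Notation E := (euclid R n).
Local Notation mu := (@lebesgue R n : {measure set E -> \bar R}).
Implicit Types (c x y : E) (r t s p : R) (Omega A : set E).
Implicit Types (phi : E -> R -> \bar R) (f : E -> \bar R).
Local Open Scope ereal_scope.

(* The library's norm (hence its [ball]) on row vectors is the sup norm. *)
Definition eball c r : set E :=
  [set x | (Num.sqrt (\sum_i (x ord0 i - c ord0 i) ^+ 2) < r)%R].

(* A function Omega x [0, oo) -> [0, oo] is represented by a total [phi]
   whose values off Omega and at negative reals are irrelevant. *)
Definition weak_Phi Omega phi : Prop :=
  [/\ forall x t, Omega x -> (0 <= t)%R -> 0 <= phi x t,
      forall f : E -> R, measurable_fun Omega f ->
        measurable_fun Omega (fun x => phi x `|f x|%R),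
      forall x s t, Omega x -> (0 <= s)%R -> (s <= t)%R -> phi x s <= phi x t,
      forall x, Omega x -> [/\ phi x 0%R = 0,
        phi x t @[t --> 0^'+] --> 0 & phi x t @[t --> +oo%R] --> +oo]
    & exists2 L : R, (1 <= L)%R &
      forall x s t, Omega x -> (0 < s)%R -> (s < t)%R ->
        phi x s * s^-1%:E <= L%:E * (phi x t * t^-1%:E)].

Definition weak_Phi_const (psi : R -> \bar R) : Prop :=
  weak_Phi setT (fun=> psi).

Definition gen_inverse phi x t : \bar R :=
  ereal_inf [set tau%:E | tau in [set tau : R | (0 <= tau)%R /\ t%:E <= phi x tau]].

Definition aInc phi p A (T : set R) : Prop :=
  exists2 a : R, (1 <= a)%R &
    forall t s, T t -> T s -> (0 < t)%R -> (t < s)%R ->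
      \forall x \ae mu, A x ->
        phi x t * (t `^ p)^-1%:E <= a%:E * (phi x s * (s `^ p)^-1%:E).

Definition aInc_infty Omega phi : Prop :=
  exists p t0 : R, [/\ (1 < p)%R, (0 < t0)%R & aInc phi p Omega `[t0, +oo[].

Definition A0 Omega phi : Prop :=
  exists beta : R, [/\ (0 < beta)%R, (beta <= 1)%R &
    \forall x \ae mu, Omega x ->
      beta%:E <= gen_inverse phi x 1 <= (beta^-1)%:E].

Definition A1 Omega phi : Prop :=
  exists beta : R, [/\ (0 < beta)%R, (beta < 1)%R &
    forall c r, (0 < r)%R -> mu (eball c r) <= 1 ->
    forall t, (1 <= t <= (fine (mu (eball c r)))^-1)%R ->
      \forall x \ae mu, \forall y \ae mu,
        (eball c r `&` Omega) x -> (eball c r `&` Omega) y ->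
        beta%:E * gen_inverse phi x t <= gen_inverse phi y t].

Definition A2 Omega phi : Prop :=
  exists (phi_oo : R -> \bar R) (h : E -> R) (beta s : R),
    [/\ weak_Phi_const phi_oo,
        mu.-integrable Omega (EFin \o h) /\
          Lnorm mu +oo ((EFin \o h) \_ Omega) < +oo,
        (0 < beta <= 1)%R, (0 < s)%R &
        \forall x \ae mu, Omega x -> forall t, (0 <= t)%R ->
          (0 <= phi_oo t <= s%:E ->
             phi x (beta * t)%R <= phi_oo t + (h x)%:E) /\
          (0 <= phi x t <= s%:E ->
             phi_oo (beta * t)%R <= phi x t + (h x)%:E)].

(* phi(x, .) extended to [0, oo] by its limit oo at oo; needed because the
   maximal function may take the value oo. *)
Definition phi_ext phi x (t : \bar R) : \bar R :=
  if t is r%:E then phi x r else +oo.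

Definition Lphi Omega phi : set (E -> \bar R) :=
  [set f | measurable_fun Omega f /\
    exists2 lambda : R, (0 < lambda)%R &
      \int[mu]_(x in Omega) phi_ext phi x (lambda%:E * `|f x|) < +oo].

Definition Lphi_norm Omega phi f : \bar R :=
  ereal_inf [set lambda%:E | lambda in [set lambda : R | (0 < lambda)%R /\
    \int[mu]_(x in Omega) phi_ext phi x (`|f x| * lambda^-1%:E) <= 1]].

Definition maximal Omega f x : \bar R :=
  ereal_sup [set ((fine (mu (eball cr.1 cr.2)))^-1)%:E *
                 \int[mu]_(y in eball cr.1 cr.2 `&` Omega) `|f y|
            | cr in [set cr : E * R | (0 < cr.2)%R /\ eball cr.1 cr.2 x]].

End generalized_orlicz.

(* Main.v *)
Require Import Defs.
From mathcomp Require Import all_boot all_order all_algebra.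
From mathcomp Require Import all_classical all_reals all_analysis.
From mathcomp Require Import measurable_realfun ess_sup_inf.
From mathcomp Require Import ring lra.
Import Order.TTheory GRing.Theory Num.Theory.
Import numFieldNormedType.Exports.
Local Open Scope classical_set_scope.
Local Open Scope ring_scope.

(** The idea is to bound phi(x, c Mf(x)) pointwise by the q-th power of an
    ordinary maximal function, where q > 1 is the smaller of the two exponents
    of the hypotheses.  Let f have modular at most 1 and put
    H = (phi(y, |f(y)|) + h(y)) ^ (1/q), where h is the error function of A2,
    so that H ^ q is integrable.  By [key_estimate], for almost every x and
    every ball B containing x, with rational centre and radius,

      phi(x, c avg_B |f|) <= C (avg_B H) ^ q + h(x).

    Taking the supremum over B and integrating, the maximal theorem in L^q
    ([qmax_strong]) bounds the modular of c Mf ([modular_bound]), and almost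
    increase of phi(x, t) / t turns a bounded modular into the norm inequality.

    The estimate replaces Jensen's inequality by a level argument.  If
    phi(y, sg) >= t, then (aInc)_q above sg gives
    t^(1/q) |f(y)| <= t^(1/q) sg + K sg H(y); when this holds at almost every
    y in B, averaging bounds avg_B |f| by a multiple of sg, once
    t^(1/q) dominates avg_B H.  It remains to find sg that works for all y and
    for which phi(x, c sg) <= t.
    - If A = avg_B H is large, integrability of H ^ q forces A ^ q to be at
      most a multiple of 1/|B|, so t comparable to A ^ q is a level admitted
      by A1, and sg is comparable to the inverse of phi(x, .) at t
      ([avg_estimate_large]).
    - If A is bounded, A2 compares phi(x, .) and phi(y, .), up to h(x) and
      h(y), with one function chi that does not depend on the point, and the
      level argument is run on chi ([avg_estimate_small]).

    In the second case chi has to satisfy (aInc)_q near zero, which phi itself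
    need not do on G.  If Omega has infinite measure, so has Omega minus G, and
    the integrable function h takes arbitrarily small values there; at such
    points y the function phi(y, .) satisfies (aInc)_q and is comparable to chi
    up to a vanishing error, so chi inherits the condition.  If Omega has finite
    measure, chi = 0 and h = 1 will do, since phi is bounded by 1 at small
    arguments.  Both cases are in [A2_two_sided], the place where G enters.

    The conditions hold almost everywhere for each fixed value of their
    parameters.  To get one null set, balls and arguments are restricted to
    rational ones and levels to powers of two, at the cost of constants. *)

(** * Lebesgue measure of boxes, open sets and balls *)

Section lebesgue_geometry.
Context {R : realType} {n : nat}.
Local Notation E := (euclid R n).
Local Notation mu := (@lebesgue R n : {measure set E -> \bar R}).

(** Cutting every box of a cover along the hyperplane costs no volume. *)
Lemma measurable_half_space (i : 'I_n.+1) (c : R) :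
  measurable [set x : E | x ord0 i <= c].
Proof.
apply: (@le_caratheodory_measurable _ _ (@lebesgue_outer R n)) => X.
apply: le_ereal_inf_tmp => _ [d [dle Xd] <-].
pose m k : R := Num.max ((d k).1 ord0 i) (Num.min ((d k).2 ord0 i) c).
pose d1 k : E * E := ((d k).1, \row_j (if j == i then m k else (d k).2 ord0 j)).
pose d2 k : E * E := (\row_j (if j == i then m k else (d k).1 ord0 j), (d k).2).
have m1 k : (d k).1 ord0 i <= m k by rewrite /m le_max lexx.
have m2 k : m k <= (d k).2 ord0 i by rewrite /m ge_max dle ge_min lexx.
have d1le k j : (d1 k).1 ord0 j <= (d1 k).2 ord0 j.
  by rewrite /d1 /= mxE; case: eqP => [->|_]; [exact: m1|exact: dle].
have d2le k j : (d2 k).1 ord0 j <= (d2 k).2 ord0 j.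
  by rewrite /d2 /= mxE; case: eqP => [->|_]; [exact: m2|exact: dle].
apply: (@le_trans _ _ (\sum_(k <oo) box_volume (d1 k) +
                       \sum_(k <oo) box_volume (d2 k))%E).
  apply: leeD; apply: ereal_inf_lbound.
    exists d1 => //; split => // x [Xx xc].
    have [k _ kx] := Xd x Xx; exists k => // j /=.
    rewrite mxE; case: eqP => [->|_]; last exact: kx.
    have /andP[h1 h2] := kx i.
    by rewrite h1 /= /m le_max le_min h2 xc orbT.
  exists d2 => //; split => // x [Xx /negP]; rewrite -ltNge => xc.
  have [k _ kx] := Xd x Xx; exists k => // j /=.
  rewrite mxE; case: eqP => [->|_]; last exact: kx.
  have /andP[h1 h2] := kx i.
  by rewrite h2 andbT /m gt_max h1 gt_min xc orbT.
rewrite -nneseriesD; last 2 first.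
- by move=> k _ _; exact: box_volume_ge0.
- by move=> k _ _; exact: box_volume_ge0.
apply: lee_nneseries => k _.
  by move=> _; apply: adde_ge0; exact: box_volume_ge0.
rewrite /box_volume -EFinD lee_fin (bigD1 i)//= [X in _ + X <= _](bigD1 i)//=.
rewrite [leRHS](bigD1 i)//= !mxE !eqxx.
rewrite (eq_bigr (fun j => (d k).2 ord0 j - (d k).1 ord0 j)); last first.
  by move=> j ji; rewrite mxE (negbTE ji).
rewrite [X in _ + _ * X <= _](eq_bigr (fun j => (d k).2 ord0 j - (d k).1 ord0 j)).
  by rewrite -mulrDl addrC -addrA (addrA (- m k)) addNr add0r.
by move=> j ji; rewrite mxE (negbTE ji).
Qed.

Lemma measurable_box (a b : E) : measurable (box a b).
Proof.
have -> : box a b = \bigcap_(i in [set: 'I_n.+1])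
    ([set x : E | x ord0 i <= b ord0 i] `\` [set x : E | x ord0 i <= a ord0 i]).
  apply/seteqP; split => [x xab i _|x xab i].
    by have /andP[h1 h2] := xab i; split => //=; apply/negP; rewrite -ltNge.
  by have [/= -> /negP] := xab i I; rewrite -ltNge => ->.
apply: fin_bigcap_measurable => // i _.
by apply: measurableD; exact: measurable_half_space.
Qed.

Definition cube (c : E) (r : R) : set E :=
  [set x | forall i, `|x ord0 i - c ord0 i| < r].

Lemma open_cube_sub (U : set E) x : open U -> U x ->
  exists2 e : R, 0 < e & cube x e `<=` U.
Proof.
rewrite openE => /[apply] /nbhs_ballP[e /= e0 xeU]; exists e => // y yx.
apply: xeU; split => // i j; rewrite ord1 /ball/= distrC; exact: yx.
Qed.

Lemma rat_row (P : 'I_n.+1 -> set R) :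
  (forall i, exists q : rat, P i (ratr q)) ->
  exists q : 'rV[rat]_n.+1, forall i, P i (ratr (q ord0 i)).
Proof.
move=> /choice[q Pq]; exists (\row_i q i) => i; by rewrite mxE.
Qed.

Definition ratv (q : 'rV[rat]_n.+1) : E := \row_i ratr (q ord0 i).

Lemma open_measurable_euclid (U : set E) : open U -> measurable U.
Proof.
move=> oU.
pose I := [set ab : 'rV[rat]_n.+1 * 'rV[rat]_n.+1 |
             box (ratv ab.1) (ratv ab.2) `<=` U].
have -> : U = \bigcup_(ab in I) box (ratv ab.1) (ratv ab.2).
  apply/seteqP; split => [x Ux|x [ab Iab]]; last exact: Iab.
  have [e e0 xeU] := open_cube_sub U x oU Ux.
  have [|a Pa] := rat_row (fun i y => x ord0 i - e < y < x ord0 i).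
    move=> i; have : x ord0 i - e < x ord0 i by rewrite ltrBlDr ltrDl.
    by move=> /rat_in_itvoo[q]; rewrite in_itv/=; exists q.
  have [|b Pb] := rat_row (fun i y => x ord0 i < y < x ord0 i + e).
    move=> i; have : x ord0 i < x ord0 i + e by rewrite ltrDl.
    by move=> /rat_in_itvoo[q]; rewrite in_itv/=; exists q.
  exists (a, b) => [y yab|i] /=.
    apply: xeU => i; rewrite ltr_norml.
    have := yab i; rewrite !mxE => /andP[h1 h2].
    have /andP[h3 h4] := Pa i; have /andP[h5 h6] := Pb i.
    by apply/andP; split; lra.
  rewrite !mxE; have /andP[h3 h4] := Pa i; have /andP[h5 h6] := Pb i.
  by rewrite h4 ltW.
rewrite bigcup_mkcond; apply: countable_bigcupT_measurable => [|ab].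
  exact: countableP.
by case: ifPn => // _; exact: measurable_box.
Qed.

End lebesgue_geometry.

Section box_volume.
Context {R : realType}.

(** Comparing a box with a countable cover amounts to integrating the
    inequality between indicators one coordinate at a time; monotone
    convergence treats all boxes of the cover at once.  The weights [v] and
    [w] collect the side lengths of the coordinates already integrated. *)
Lemma prod_indic_le_series (m : nat) (v : R) (a b : nat -> R)
    (w : nat -> R) (A B : nat -> nat -> R) :
  0 <= v -> (forall i, a i <= b i) ->
  (forall k, 0 <= w k) -> (forall k i, A k i <= B k i) ->
  (forall x : nat -> R,
    ((v * \prod_(i < m) \1_(`]a i, b i]%classic) (x i))%:E <=
     \sum_(k <oo) (w k * \prod_(i < m) \1_(`]A k i, B k i]%classic) (x i))%:E)%E) ->
  ((v * \prod_(i < m) (b i - a i))%:E <=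
     \sum_(k <oo) (w k * \prod_(i < m) (B k i - A k i))%:E)%E.
Proof.
elim: m v w => [|m IH] v w v0 ab w0 AB H.
  have := H (fun=> 0); rewrite !big_ord0.
  under eq_eseriesr do rewrite big_ord0.
  move=> /le_trans; apply.
  by under [leRHS]eq_eseriesr do rewrite big_ord0.
rewrite big_ord_recr/= mulrA mulrAC.
under eq_eseriesr do rewrite big_ord_recr/= mulrA mulrAC.
apply: IH => //.
- by rewrite mulr_ge0// subr_ge0.
- by move=> k; rewrite mulr_ge0// subr_ge0.
move=> x.
pose xy (y : R) i := if i == m then y else x i.
have Hy y : ((v * \prod_(i < m) \1_(`]a i, b i]%classic) (x i) * \1_(`]a m,
  b m]%classic) y)%:E <=
  \sum_(k <oo) (w k * (\prod_(i < m) \1_(`]A k i, B k i]%classic) (x i)) * \1_(`]A k m,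
    B k m]%classic) y)%:E)%E.
  have prE (f g : nat -> R) : \prod_(i < m.+1) \1_(`]f i, g i]%classic) (xy y i) =
     (\prod_(i < m) \1_(`]f i, g i]%classic) (x i)) * \1_(`]f m, g m]%classic) y :> R.
    rewrite big_ord_recr/= /xy eqxx; congr (_ * _).
    by apply: eq_bigr => i _; rewrite (ltn_eqF (ltn_ord i)).
  have := H (xy y); rewrite prE mulrA => /le_trans; apply.
  by apply: lee_nneseries => k; rewrite prE mulrA// => _ _;
    rewrite lee_fin !mulr_ge0// prodr_ge0.
have intE (u c d : R) : 0 <= u -> c <= d ->
  (\int[@lebesgue_measure R]_y (u * \1_(`]c, d]%classic) y)%:E = (u * (d - c))%:E)%E.
  move=> u0 cd; under eq_integral do rewrite EFinM.
  rewrite ge0_integralZl//; last first.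
    by apply/measurable_EFinP; exact: measurable_indic.
  have muE : @lebesgue_measure R `]c, d]%classic = (d - c)%:E.
    rewrite lebesgue_measure_itv/= lte_fin; case: ltP => // dc.
    by rewrite (@le_anti _ _ c d) ?cd// subrr.
  by rewrite integral_indic// setIT /= muE EFinM.
rewrite mulrAC -intE//; last by rewrite mulr_ge0// prodr_ge0.
apply: (@le_trans _ _ (\int[@lebesgue_measure R]_y \sum_(k <oo)
  (w k * (\prod_(i < m) \1_(`]A k i, B k i]%classic) (x i)) * \1_(`]A k m,
    B k m]%classic) y)%:E)%E).
  apply: ge0_le_integral => // [y _||].
  - by rewrite lee_fin !mulr_ge0// prodr_ge0.
  - by apply/measurable_EFinP; apply: measurable_funM => //; exact: measurable_indic.
  - apply: ge0_emeasurable_sum => [k y _ _|k _].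
      by rewrite lee_fin !mulr_ge0// prodr_ge0.
    by apply/measurable_EFinP; apply: measurable_funM => //; exact: measurable_indic.
rewrite integral_nneseries//; last 2 first.
- move=> k; apply/measurable_EFinP; apply: measurable_funM => //; exact: measurable_indic.
- by move=> k y _; rewrite lee_fin !mulr_ge0// prodr_ge0.
apply: lee_nneseries => [k _ _|k _].
  by apply: integral_ge0 => y _; rewrite lee_fin !mulr_ge0// prodr_ge0.
by rewrite intE//; [rewrite mulrAC | rewrite mulr_ge0// prodr_ge0].
Qed.

End box_volume.

Section lebesgue_balls.
Context {R : realType} {n : nat}.
Local Notation E := (euclid R n).
Local Notation mu := (@lebesgue R n : {measure set E -> \bar R}).

Lemma lebesgue_box_ge (a b : E) : (forall i, a ord0 i <= b ord0 i) ->
  (box_volume (a, b) <= mu (box a b))%E.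
Proof.
move=> ab; apply: le_ereal_inf_tmp => _ [c [cle abc] <-].
pose e (x : E) (i : nat) : R := x ord0 (inord i).
have eE (x : E) (i : 'I_n.+1) : e x i = x ord0 i by rewrite /e inord_val.
have volE (x y : E) : \prod_i (y ord0 i - x ord0 i) = 1 * \prod_(i < n.+1) (e y i - e x i).
  by rewrite mul1r; apply: eq_bigr => i _; rewrite !eE.
rewrite /box_volume/= volE.
under eq_eseriesr do rewrite volE.
have indE (x y : E) (z : nat -> R) : \prod_(i < n.+1) \1_(`]e x i, e y i]%classic) (z i) =
    \1_(box x y) (\row_i z i) :> R.
  rewrite [RHS]indicE; case: (boolP (_ \in _)) => [|xyz].
    rewrite inE => xyz; apply: big1 => i _; rewrite indicE mem_set//= in_itv/= !eE.
    by have := xyz i; rewrite mxE.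
  have [i zi] : exists i : 'I_n.+1, ~~ (z i \in `]x ord0 i, y ord0 i]).
    apply/existsP; rewrite -negb_forall; apply: contra xyz => /forallP xyz.
    by rewrite inE => i; rewrite mxE; have := xyz i; rewrite in_itv.
  rewrite (bigD1 i)//= indicE memNset ?mul0r//= !eE.
  exact/negP.
apply: (@prod_indic_le_series _ n.+1 1 (e a) (e b) (fun=> 1)
  (fun k => e (c k).1) (fun k => e (c k).2)) => // [i|k i|z]; rewrite ?indE.
- exact: ab.
- exact: cle.
under eq_eseriesr do rewrite indE mul1r.
rewrite mul1r indicE; case: (boolP (_ \in _)) => [|_].
  rewrite inE => /abc[k _ kz].
  apply: le_trans (nneseries_lim_ge k.+1 _); last by move=> j _ _; rewrite lee_fin.
  rewrite big_nat_recr//= indicE mem_set//.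
  by rewrite leeDr// sume_ge0// => j _; rewrite lee_fin.
by apply: nneseries_ge0 => j _ _; rewrite lee_fin.
Qed.

Lemma lebesgue_cube_le (c : E) (r : R) : 0 < r ->
  (mu (cube c r) <= ((2 * r) ^+ n.+1)%:E)%E.
Proof.
move=> r0.
pose d k : E * E := if k is 0%N then (\row_i (c ord0 i - r), \row_i (c ord0 i + r)) else (0, 0).
apply: (@le_trans _ _ (\sum_(k <oo) box_volume (d k))%E).
  apply: ereal_inf_lbound; exists d => //; split => [[|k] i//=|x xc].
    by rewrite !mxE; lra.
  exists 0%N => // i; rewrite !mxE; have := xc i; rewrite ltr_norml => /andP[h1 h2].
  by apply/andP; split; lra.
rewrite (nneseries_split 0 1)/=; last by move=> [|k] _; apply: box_volume_ge0 => i//=;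
  rewrite !mxE; lra.
rewrite big_nat1 add0n eseries0; last first.
  by move=> [|k]//= _ _; rewrite /box_volume/= (bigD1 ord0)//= !mxE subrr mul0r.
rewrite adde0 /box_volume/= lee_fin (eq_bigr (fun=> 2 * r)) ?prodr_const ?card_ord//.
by move=> i _; rewrite !mxE; lra.
Qed.

Lemma open_eball (c : E) (r : R) : open (eball c r).
Proof.
have -> : eball c r = (fun x : E =>
  Num.sqrt (\sum_i (x ord0 i - c ord0 i) ^+ 2)) @^-1` [set y | y < r] by [].
apply: open_comp; last exact: open_lt.
move=> x _; apply: continuous_comp; last exact: sqrt_continuous.
move: x; apply: (@continuous_big _ _ _ _ _ _ E _ (fun i (x : E) => (x ord0 i - c ord0 i) ^+ 2)).
  exact: add_continuous.
move=> i _ x; apply: (@continuous_comp _ _ _ (fun x : E => x ord0 i - c ord0 i) (fun y : R =>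
  y ^+ 2)); last exact: exprn_continuous.
apply: (@continuousB _ _ E (fun x : E => x ord0 i) (fun=> c ord0 i));
  last exact: cst_continuous.
exact: coord_continuous.
Qed.

Lemma measurable_eball (c : E) (r : R) : measurable (eball c r).
Proof. by apply: open_measurable_euclid; exact: open_eball. Qed.

Lemma eball_center (c : E) (r : R) : 0 < r -> eball c r c.
Proof. by move=> r0; rewrite /eball/= big1 ?sqrtr0// => i _; rewrite subrr expr0n. Qed.

Lemma eball_sub_cube (c : E) (r : R) : eball c r `<=` cube c r.
Proof.
move=> x /=; rewrite /eball/= => xr i; apply: le_lt_trans xr.
rewrite -sqrtr_sqr ler_sqrt ?sumr_ge0//; last by move=> j _; rewrite sqr_ge0.
rewrite (bigD1 i)//= lerDl sumr_ge0// => j _; exact: sqr_ge0.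
Qed.

Lemma natr_sqr_le (d : R) : n.+1%:R * (2 * d ^+ 2) <= (n.+1%:R * (2 * d)) ^+ 2.
Proof.
have : 1 <= n.+1%:R :> R by rewrite ler1n.
move: (n.+1%:R) => N N1; rewrite [leRHS](_ : _ = N * (2 * d ^+ 2) * (2 * N)); last by ring.
by rewrite ler_peMr; [|have := sqr_ge0 d; nra|lra].
Qed.

(** A cube of half-side r / (2 (n+1)) is inscribed in a ball of radius r. *)
Lemma half_sideE (r : R) : r = n.+1%:R * (2 * (r / n.+1.*2%:R)).
Proof.
have : n.+1%:R != 0 :> R by rewrite pnatr_eq0.
by rewrite -muln2 natrM; move: (n.+1%:R) => N N0; field.
Qed.

Lemma box_sub_eball (c : E) (r : R) : 0 < r ->
  box (\row_i (c ord0 i - r / n.+1.*2%:R)) (\row_i (c ord0 i + r / n.+1.*2%:R))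
    `<=` eball c r.
Proof.
move=> r0 x xr; rewrite /eball/= -(gtr0_norm r0) -sqrtr_sqr ltr_sqrt ?exprn_gt0//.
set d := r / _ in xr.
have d0 : 0 < d by rewrite divr_gt0.
have rE : r = n.+1%:R * (2 * d) by rewrite /d; exact: half_sideE.
apply: (@le_lt_trans _ _ (\sum_(i < n.+1) d ^+ 2)).
  apply: ler_sum => i _; rewrite -real_normK ?num_real// lerXn2r ?nnegrE ?(ltW d0)//.
  have := xr i; rewrite !mxE => /andP[h1 h2]; rewrite ler_norml.
  by apply/andP; split; lra.
rewrite sumr_const card_ord rE -[X in X < _]mulr_natl; apply: lt_le_trans (natr_sqr_le d).
by rewrite ltr_pM2l// ltr_pMl ?exprn_gt0// ltr1n.
Qed.

Lemma lebesgue_eball_le (c : E) (r : R) : 0 < r ->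
  (mu (eball c r) <= ((2 * r) ^+ n.+1)%:E)%E.
Proof.
move=> r0; apply: le_trans (lebesgue_cube_le c r r0).
by apply: le_outer_measure; exact: eball_sub_cube.
Qed.

Lemma lebesgue_eball_ge (c : E) (r : R) : 0 < r ->
  (((r / n.+1%:R) ^+ n.+1)%:E <= mu (eball c r))%E.
Proof.
move=> r0; pose d := r / n.+1.*2%:R.
have d0 : 0 < d by rewrite divr_gt0.
have h (i : 'I_n.+1) : (\row_i (c ord0 i - d) : E) ord0 i <= (\row_i (c ord0 i + d) : E) ord0 i.
  by rewrite !mxE; lra.
apply: le_trans (le_outer_measure (@lebesgue_outer R n) _ _ (box_sub_eball c r r0)).
apply: le_trans (lebesgue_box_ge _ _ h).
rewrite /box_volume/= lee_fin (eq_bigr (fun=> r / n.+1%:R)) ?prodr_const ?card_ord//.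
move=> i _; rewrite !mxE; have -> : r / n.+1%:R = 2 * d; last by lra.
by rewrite [X in X / _](half_sideE r) mulrAC divff ?mul1r// pnatr_eq0.
Qed.

Lemma lebesgue_eball_fin (c : E) (r : R) : 0 < r -> mu (eball c r) \is a fin_num.
Proof.
move=> r0; rewrite ge0_fin_numE//; apply: le_lt_trans (ltry _).
exact: lebesgue_eball_le.
Qed.

Lemma lebesgue_eball_gt0 (c : E) (r : R) : 0 < r -> 0 < fine (mu (eball c r)).
Proof.
move=> r0; rewrite -lte_fin fineK ?lebesgue_eball_fin//.
by apply: lt_le_trans (lebesgue_eball_ge c r r0); rewrite lte_fin exprn_gt0// divr_gt0.
Qed.

(** A cube of half-side 6 r has volume (12 r)^(n+1), and a ball of radius r
    contains a cube of side r / (n+1). *)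
Definition doubling_const : R := (12 * n.+1%:R) ^+ n.+1.

Lemma lebesgue_cube_le_eball (c c' : E) (r s : R) : 0 < r -> 0 < s -> s <= 6 * r ->
  (mu (cube c' s) <= (doubling_const * fine (mu (eball c r)))%:E)%E.
Proof.
move=> r0 s0 sr; apply: (le_trans (lebesgue_cube_le c' s s0)).
rewrite lee_fin; apply: (@le_trans _ _ (doubling_const * (r / n.+1%:R) ^+ n.+1)).
  rewrite /doubling_const -exprMn lerXn2r ?nnegrE//.
  - by rewrite mulr_ge0// ltW.
  - by rewrite !mulr_ge0// ltW.
  - rewrite [leRHS](_ : _ = 12 * r); first lra.
    by rewrite -mulrA [n.+1%:R * _]mulrC divfK// pnatr_eq0.
rewrite ler_wpM2l ?exprn_ge0 ?mulr_ge0//.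
by rewrite -lee_fin fineK ?lebesgue_eball_fin//; exact: lebesgue_eball_ge.
Qed.

(** Enumeration of the pairs of a rational centre and a positive rational
    radius; all other codes denote the unit ball. *)
Definition rat_ball (k : nat) : E * R :=
  if unpickle k is Some (q, r) then
    if 0 < r :> rat then (ratv q, ratr r) else (0, 1)
  else (0, 1).
Definition qball k : set E := eball (rat_ball k).1 (rat_ball k).2.

Lemma rat_ball_gt0 k : 0 < (rat_ball k).2.
Proof.
rewrite /rat_ball; case: unpickle => // -[q r]; case: ifPn => //= r0.
by rewrite ltr0q.
Qed.

(** With a radius between 2 r and 3 r there is room to move the centre to a
    rational point, so that every ball lies in a rational one of comparable
    measure. *)
Lemma eball_sub_qball (c : E) (r : R) : 0 < r -> exists2 k,
  eball c r `<=` qball k &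
  (mu (qball k) <= (doubling_const * fine (mu (eball c r)))%:E)%E.
Proof.
move=> r0; pose d := r / n.+1.*2%:R.
have d0 : 0 < d by rewrite divr_gt0.
have [q Pq] : exists q : 'rV[rat]_n.+1, forall i, c ord0 i - d < ratr (q ord0 i) < c ord0 i + d.
  apply: (rat_row (fun i y => c ord0 i - d < y < c ord0 i + d)) => i.
  have : c ord0 i - d < c ord0 i + d by lra.
  by move=> /rat_in_itvoo[q]; rewrite in_itv/=; exists q.
have [s] : exists s : rat, ratr s \in `](2 * r), (3 * r)[.
  have : 2 * r < 3 * r by lra.
  by move=> /rat_in_itvoo[s]; exists s.
rewrite in_itv/= => /andP[rs sr].
have s0 : 0 < s by rewrite -(ltr0q R); lra.
have kE : rat_ball (pickle (q, s)) = (ratv q, ratr s).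
  by rewrite /rat_ball pickleK s0.
exists (pickle (q, s)).
  move=> x; rewrite /qball kE /eball/= => xr.
  apply: lt_trans rs.
  have r20 : 0 <= 2 * r by lra.
  rewrite -(ger0_norm r20) -sqrtr_sqr ltr_sqrt; last by rewrite exprn_gt0; lra.
  have {}xr : \sum_i (x ord0 i - c ord0 i) ^+ 2 < r ^+ 2.
    by rewrite -ltr_sqrt ?exprn_gt0// sqrtr_sqr gtr0_norm.
  apply: (@le_lt_trans _ _ (\sum_i (2 * (x ord0 i - c ord0 i) ^+ 2 + 2 * d ^+ 2))).
    apply: ler_sum => i _; rewrite mxE; have /andP[] := Pq i.
    set y := ratr _; set z := c _ _; set w := x _ _ => h1 h2.
    have : (z - y) ^+ 2 <= d ^+ 2.
      rewrite -real_normK ?num_real// lerXn2r ?nnegrE ?(ltW d0)// ler_norml.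
      by apply/andP; split; lra.
    have := sqr_ge0 (w - z - (z - y)); nra.
  rewrite big_split/= -mulr_sumr sumr_const card_ord -[_ *+ n.+1]mulr_natl.
  have rE : r = n.+1%:R * (2 * d) by rewrite /d; exact: half_sideE.
  have := natr_sqr_le d; rewrite -rE => nd.
  have : 0 < r ^+ 2 by rewrite exprn_gt0.
  by rewrite [(2 * r) ^+ 2]exprMn; lra.
rewrite /qball kE/=.
apply: le_trans (lebesgue_cube_le_eball c (ratv q) r (ratr s) r0 _ _); [|lra..].
by apply: le_outer_measure; exact: eball_sub_cube.
Qed.

End lebesgue_balls.

(** * The maximal theorem *)

Section vitali.
Context {R : realType} {n : nat}.
Local Notation E := (euclid R n).

(** Greedy selection by decreasing radius: a cube is either disjoint from those already
  selected, or it
    meets one that is not smaller, whose triple then contains it. *)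
Lemma vitali_cubes (c : nat -> E) (r : nat -> R) (s : seq nat) :
  (forall i, 0 < r i) ->
  exists D : seq nat, [/\ uniq D, {subset D <= s},
    trivIset [set` D] (fun i => cube (c i) (r i)) &
    forall i, i \in s -> exists2 j, j \in D &
      cube (c i) (r i) `<=` cube (c j) (3 * r j)].
Proof.
move=> r0; pose le i j := r i <= r j.
have le_tr : transitive le by move=> x y z; exact: le_trans.
have sub3 j : cube (c j) (r j) `<=` cube (c j) (3 * r j).
  by move=> x xj i; apply: lt_le_trans (xj i) _; have := r0 j; lra.
wlog : s / sorted le s.
  have : sorted le (sort le s) by apply: sort_sorted => x y; exact: le_total.
  move=> /[swap] /[apply] -[D [uD Ds tD H]]; exists D; split => //.
  - by move=> x /Ds; rewrite mem_sort.
  - by move=> i; rewrite -(mem_sort le) => /H.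
elim: s => [_|i s IH]; first by exists [::]; split => // i j; rewrite set_nil.
rewrite /= (path_sortedE le_tr) => /andP[/allP is_ /IH[D [uD Ds tD H]]].
have [dis|] := pselect (forall j, j \in D ->
    cube (c j) (r j) `&` cube (c i) (r i) = set0).
  have iD : i \notin D.
    apply/negP => /dis; rewrite setIid => /eqP; apply/negP/set0P.
    by exists (c i) => k; rewrite subrr normr0.
  exists (i :: D); split => //=; first by rewrite iD.
  - by move=> x; rewrite !inE => /predU1P[->|/Ds ->]; rewrite ?eqxx ?orbT.
  - move=> k l /=; rewrite !inE => /predU1P[->{k}|kD] /predU1P[->{l}|lD] //.
    + by rewrite setIC dis// => /set0P; rewrite eqxx.
    + by rewrite dis// => /set0P; rewrite eqxx.
    + exact: tD.
  - move=> k; rewrite inE => /predU1P[->|/H[j jD kj]].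
      by exists i => //; rewrite inE eqxx.
    by exists j => //; rewrite inE jD orbT.
move=> /existsNP[j /not_implyP[jD /eqP/set0P[x [xj xi]]]].
exists D; split => //; first by move=> k /Ds; rewrite inE orbC => ->.
move=> k; rewrite inE => /predU1P[->|/H//]; exists j => // y yi m.
have ij : r i <= r j by apply: is_; exact: Ds.
have := xj m; have := xi m; have := yi m; rewrite !ltr_norml.
move=> /andP[h1 h2] /andP[h3 h4] /andP[h5 h6].
by apply/andP; split; lra.
Qed.

End vitali.

Section maximal_theorem.
Context {R : realType} {n : nat}.
Local Notation E := (euclid R n).
Local Notation mu := (@lebesgue R n : {measure set E -> \bar R}).
Local Open Scope ereal_scope.
Local Notation rb := (@rat_ball R n).
Implicit Types (F : E -> \bar R).

Definition avg F (k : nat) : \bar R :=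
  ((fine (mu (qball k)))^-1)%:E * \int[mu]_(y in qball k) F y.

(** The maximal function over rational balls, a countable supremum. *)
Definition qmax F (x : E) : \bar R :=
  ereal_sup [set avg F k | k in [set k | qball k x]].

Lemma measurable_qball k : measurable (@qball R n k).
Proof. exact: measurable_eball. Qed.

Lemma qball_gt0 k : (0 < fine (mu (@qball R n k)))%R.
Proof. by apply: lebesgue_eball_gt0; exact: rat_ball_gt0. Qed.

Lemma qballE k : mu (@qball R n k) = (fine (mu (@qball R n k)))%:E.
Proof. by rewrite fineK//; apply: lebesgue_eball_fin; exact: rat_ball_gt0. Qed.

Lemma avg_ge0 F k : (forall x, 0 <= F x) -> 0 <= avg F k.
Proof.
by move=> F0; rewrite mule_ge0 ?integral_ge0// lee_fin invr_ge0.
Qed.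

Lemma lt_qmaxE F (l : \bar R) : [set x | l < qmax F x] =
  \bigcup_(k in [set k | l < avg F k]) qball k.
Proof.
apply/seteqP; split => [x /ereal_sup_gtP[_ [k kx <-] lk]|x [k /= lk kx]].
  by exists k.
by apply/ereal_sup_gtP; exists (avg F k) => //; exists k.
Qed.

Lemma measurable_qmax F : measurable_fun setT (qmax F).
Proof.
move=> mD; apply: (measurability _ (ErealGenOInfty.measurableE R)) => //.
move=> _ [_ [y ->] <-]; rewrite setTI.
have -> : qmax F @^-1` `]y%:E, +oo[ = [set x | y%:E < qmax F x].
  by apply/seteqP; split => x /=; rewrite in_itv/= andbT.
by rewrite lt_qmaxE; apply: bigcup_measurable => k _; exact: measurable_qball.
Qed.

(** The weak (1,1) inequality: Vitali's lemma bounds the measure of a finite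
    union of balls of large average, and continuity from below gives the
    whole superlevel set. *)
Lemma qmax_weak F (l : R) : (0 < l)%R -> measurable_fun setT F ->
  (forall x, 0 <= F x) ->
  l%:E * mu [set x | l%:E < qmax F x] <= (@doubling_const R n)%:E * \int[mu]_x F x.
Proof.
move=> l0 mF F0; set C := doubling_const.
have C0 : (0 <= C)%R by rewrite exprn_ge0// mulr_ge0.
pose K := [set k | l%:E < avg F k].
pose U N := \bigcup_(k in [set k | (k < N)%N /\ K k]) @qball R n k.
have mB := @measurable_qball.
have mU N : measurable (U N) by apply: bigcup_measurable => k _; exact: mB.
have -> : [set x | l%:E < qmax F x] = \bigcup_N U N.
  rewrite lt_qmaxE; apply/seteqP; split => [x [k Kk kx]|x [N _ [k [_ Kk] kx]]].
    by exists k.+1 => //; exists k.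
  by exists k.
have Ule N : l%:E * mu (U N) <= C%:E * \int[mu]_x F x.
  pose s := [seq k <- iota 0 N | `[< K k >]].
  have [D [uD Ds tD H]] := vitali_cubes (fun k => (rb k).1)
    (fun k => (rb k).2) s (@rat_ball_gt0 R n).
  have DK j : j \in D -> K j by move=> /Ds; rewrite mem_filter => /andP[/asboolP].
  have UD : U N `<=` \big[setU/set0]_(j <- D) cube (rb j).1 (3 * (rb j).2).
    move=> x [k [kN Kk] kx]; rewrite -bigcup_seq.
    have [|j jD kj] := H k; last by exists j => //; apply: kj; exact: eball_sub_cube.
    by rewrite mem_filter mem_iota asboolT.
  have tDq : trivIset [set` D] (@qball R n).
    by move=> i j iD jD [x [xi xj]]; apply: tD => //; exists x; split; exact: eball_sub_cube.
  apply: (@le_trans _ _ (C%:E * \sum_(j <- D) \int[mu]_(y in qball j) F y)); last first.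
    rewrite lee_pmul// ?sume_ge0//; first by move=> j _; exact: integral_ge0.
    have mD : measurable (\big[setU/set0]_(j <- D) @qball R n j).
      by apply: bigsetU_measurable => j _; exact: mB.
    rewrite -ge0_integral_bigsetU; [|by move=> j; exact: mB|exact: uD|exact: tDq| |by []];
      last first.
      by apply: measurable_funS mF.
    by apply: ge0_subset_integral; [exact: mD|exact: measurableT|exact: mF|by []|].
  apply: (@le_trans _ _ (l%:E * \sum_(j <- D) C%:E * mu (qball j))).
    rewrite lee_pmul2l// ?lte_fin//.
    apply: (le_trans (le_outer_measure (@lebesgue_outer R n) _ _ UD)).
    elim: D {uD Ds tD H DK UD tDq} => [|j D IH]; first by rewrite !big_nil outer_measure0.
    rewrite !big_cons; apply: (le_trans (outer_measureU2 _ _ _)); apply: leeD => //.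
    rewrite qballE -EFinM; apply: lebesgue_cube_le_eball; first exact: rat_ball_gt0.
      by rewrite mulr_gt0// rat_ball_gt0.
    by have := @rat_ball_gt0 R n j; lra.
  rewrite -ge0_sume_distrr; last by move=> j _; exact: measure_ge0.
  rewrite muleCA lee_pmul2l//; last first.
    by rewrite lte_fin exprn_gt0// mulr_gt0.
  rewrite ge0_sume_distrr; last by move=> j _; exact: measure_ge0.
  rewrite !big_seq; apply: lee_sum => j /DK /ltW.
  by rewrite /avg qballE lee_pdivlMl ?qball_gt0// muleC.
rewrite -lee_pdivlMl//.
have cvgU : mu (U N) @[N --> \oo] --> mu (\bigcup_N U N).
  apply: nondecreasing_cvg_mu => //; first exact: bigcup_measurable.
  move=> N M NM; apply/subsetPset => x [k [kN Kk] kx]; exists k => //; split => //.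
  exact: leq_trans kN NM.
rewrite -(cvg_lim _ cvgU)//; apply: lime_le; first by apply/cvg_ex; eexists; exact: cvgU.
by apply: nearW => N; rewrite lee_pdivlMl.
Qed.

End maximal_theorem.

Section dyadic.
Context {R : realType}.

Lemma dyadic_between (e y : R) : 0 < e -> e < y ->
  exists k : nat, e * 2 ^+ k < y <= e * 2 ^+ k.+1.
Proof.
move=> e0 ey.
have exN : exists N, y <= e * 2 ^+ N.
  exists (Num.bound (y / e)); rewrite mulrC -ler_pdivrMr//.
  apply: ltW; apply: lt_le_trans (archi_boundP _) _;
    first by rewrite divr_ge0 ?ltW// (lt_trans e0).
  by rewrite -natrX ler_nat ltnW// ltn_expl.
case: (ex_minnP exN) => -[|N]; first by rewrite expr0 mulr1 leNgt ey.
move=> yN Nmin; exists N; rewrite yN andbT ltNge; apply/negP => /Nmin.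
by rewrite ltnn.
Qed.

(** The terms with e 2^k < Y form a geometric progression, dominated by its
    last term; the minimum with 2 Y lets the induction run past that term. *)
Lemma dyadic_sum_le (r e Y : R) (N : nat) : 0 < r -> 0 < e -> 0 <= Y ->
  (\sum_(0 <= k < N) (if e * 2 ^+ k < Y then (e * 2 ^+ k) `^ r else 0)) * (2 `^ r - 1)
    <= (Num.min (e * 2 ^+ N) (2 * Y)) `^ r.
Proof.
move=> r0 e0 Y0.
have pos k : 0 < e * 2 ^+ k by rewrite mulr_gt0// exprn_gt0.
elim: N => [|N IH]; first by rewrite big_nil mul0r powR_ge0.
rewrite big_nat_recr//= mulrDl.
have eN : e * 2 ^+ N.+1 = 2 * (e * 2 ^+ N) by rewrite exprS mulrCA.
case: ifPn => [NY|]; last first.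
  rewrite -leNgt => YN; rewrite mul0r addr0; apply: le_trans IH _.
  apply: ge0_ler_powR; rewrite ?nnegrE ?(ltW r0)//.
  - by rewrite le_min (ltW (pos _))/= mulr_ge0.
  - by rewrite le_min (ltW (pos _))/= mulr_ge0.
  - by rewrite le_min !ge_min lexx orbT andbT eN; have := pos N; lra.
have minN : Num.min (e * 2 ^+ N.+1) (2 * Y) = e * 2 ^+ N.+1.
  by apply/min_idPl; rewrite eN; lra.
rewrite minN eN [leRHS]powRM// ?(ltW (pos _))//.
have : Num.min (e * 2 ^+ N) (2 * Y) `^ r <= (e * 2 ^+ N) `^ r.
  apply: ge0_ler_powR; rewrite ?nnegrE ?(ltW r0) ?(ltW (pos _))//.
  - by rewrite le_min (ltW (pos _))/= mulr_ge0.
  - by rewrite ge_min lexx.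
move=> h; apply: le_trans (lerD (le_trans IH h) (lexx _)) _.
by rewrite mulrBr mulr1 addrC subrK mulrC.
Qed.

End dyadic.

Section maximal_theorem_strong.
Context {R : realType} {n : nat}.
Local Notation E := (euclid R n).
Local Notation mu := (@lebesgue R n : {measure set E -> \bar R}).
Local Open Scope ereal_scope.
Implicit Types (F H : E -> \bar R).

Lemma avg_le_affine F H (a K : R) k : measurable_fun setT F ->
  measurable_fun setT H -> (forall x, 0 <= F x) -> (forall x, 0 <= H x) ->
  (0 <= a)%R -> (0 <= K)%R ->
  (\forall y \ae mu, qball k y -> F y <= a%:E + K%:E * H y) ->
  avg F k <= a%:E + K%:E * avg H k.
Proof.
move=> mF mH F0 H0 a0 K0 FH.
have mB := @measurable_qball R n k.
have mKH : measurable_fun (qball k) (fun y => K%:E * H y).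
  by apply: measurable_funeM; exact: measurable_funS mH.
rewrite {1}/avg lee_pdivrMl ?qball_gt0//.
apply: (@le_trans _ _ (\int[mu]_(y in qball k) (a%:E + K%:E * H y))).
  apply: ae_ge0_le_integral; [exact: measurable_qball|by []| | | |exact: FH].
  - exact: measurable_funS mF.
  - by move=> y _; rewrite adde_ge0 ?mule_ge0.
  - exact: emeasurable_funD.
rewrite ge0_integralD//; last by move=> y _; rewrite mule_ge0.
rewrite ge0_integralZl//; last exact: measurable_funS mH.
rewrite integral_cst// [leRHS]ge0_muleDr ?lee_fin//;
  last by rewrite mule_ge0 ?lee_fin// avg_ge0.
rewrite /avg; apply: leeD; first by rewrite qballE muleC.
rewrite [leRHS]muleCA [X in _ <= _ * X]muleA -EFinM divff ?mul1e//.
by rewrite gt_eqF// qball_gt0.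
Qed.

Definition cutoff F (l : R) x : \bar R := if l%:E < F x then F x else 0.

Lemma cutoff_ge0 F l : (forall x, 0 <= F x) -> forall x, 0 <= cutoff F l x.
Proof. by move=> F0 x; rewrite /cutoff; case: ifP. Qed.

Lemma measurable_cutoff F l : measurable_fun setT F -> measurable_fun setT (cutoff F l).
Proof.
move=> mF; apply: measurable_fun_ifT; [|exact: mF|exact: measurable_cst].
by apply: measurable_fun_lte; [exact: measurable_cst|exact: mF].
Qed.

(** The part of F below l contributes at most l to any average, so only the
    part above l matters for the level 2 l. *)
Lemma qmax_weak_cutoff F (l : R) : (0 < l)%R -> measurable_fun setT F ->
  (forall x, 0 <= F x) ->
  l%:E * mu [set x | (2 * l)%:E < qmax F x] <=
    (@doubling_const R n)%:E * \int[mu]_x cutoff F l x.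
Proof.
move=> l0 mF F0.
have mc := measurable_cutoff F l mF; have c0 := cutoff_ge0 F l F0.
apply: le_trans (qmax_weak _ l l0 mc c0).
apply: lee_wpmul2l; first by rewrite lee_fin ltW.
apply: le_outer_measure.
rewrite !lt_qmaxE => x [k /= kl kx]; exists k => //=.
rewrite ltNge; apply/negP => kl'; move: kl; rewrite ltNge => /negP; apply.
apply: (@le_trans _ _ (l%:E + 1%:E * avg (cutoff F l) k)).
  apply: avg_le_affine => //; first exact: ltW.
  apply: aeW => y _; rewrite mul1e /cutoff; case: ifPn => [_|].
    by rewrite leeDr// lee_fin ltW.
  by rewrite -leNgt adde0.
by rewrite mul1e mulr_natl mulr2n EFinD leeD2l.
Qed.

Lemma measurable_lt_qmax F (l : \bar R) : measurable [set x | l < qmax F x].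
Proof. by rewrite lt_qmaxE; apply: bigcup_measurable => k _; exact: measurable_qball. Qed.

(** Marcinkiewicz interpolation by summing the weak inequality over the dyadic
    levels e 2^k with k >= 0; dropping the points where the maximal function
    is at most 2 e makes the sum one-sided. *)
Lemma qmax_strong_trunc (q e : R) F : (1 < q)%R -> (0 < e)%R ->
  measurable_fun setT F -> (forall x, 0 <= F x) ->
  \int[mu]_x (if (2 * e)%:E < qmax F x then (qmax F x) `^ q else 0) <=
  (4 `^ q * @doubling_const R n * (2 `^ (q - 1) / (2 `^ (q - 1) - 1)))%:E *
    \int[mu]_x (F x) `^ q.
Proof.
move=> q1 e0 mF F0.
pose l (k : nat) : R := (e * 2 ^+ k)%R; set C := @doubling_const R n.
have l0 k : (0 < l k)%R by rewrite mulr_gt0// exprn_gt0.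
have C0 : (0 < C)%R by rewrite exprn_gt0// mulr_gt0.
have q0 : (0 < q)%R by lra.
have r0 : (0 < q - 1)%R by lra.
have x1 : (1 < 2 `^ (q - 1) :> R)%R.
  have := @gt0_ltr_powR R _ r0 1%R 2%R; rewrite powR1; apply; rewrite ?nnegrE; lra.
pose ind k (x : E) := (\1_[set x | (2 * l k)%:E < qmax F x] x : R).
have mind k : measurable_fun setT (fun x => (ind k x)%:E).
  by apply/measurable_EFinP; apply: measurable_indic; exact: measurable_lt_qmax.
apply: (@le_trans _ _ (\int[mu]_x \sum_(k <oo) ((4 * l k) `^ q)%:E * (ind k x)%:E)).
  have t0 k x : 0 <= ((4 * l k) `^ q)%:E * (ind k x)%:E.
    by rewrite -EFinM lee_fin mulr_ge0 ?powR_ge0.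
  have H x (y : R) : (2 * e < y)%R -> y%:E <= qmax F x ->
      (y `^ q)%:E <= \sum_(k <oo) ((4 * l k) `^ q)%:E * (ind k x)%:E.
    move=> ey ym; have e20 : (0 < 2 * e)%R by lra.
    have [k /andP[k1 k2]] := dyadic_between (2 * e) y e20 ey.
    apply: le_trans (nneseries_lim_ge k.+1 _); last by move=> j _ _; exact: t0.
    rewrite big_nat_recr//=; apply: (@le_trans _ _ (((4 * l k) `^ q)%:E * (ind k x)%:E));
      last first.
      by rewrite leeDr// sume_ge0.
    rewrite /ind indicE mem_set/= ?mule1; last first.
      by apply: lt_le_trans ym; rewrite lte_fin /l mulrA.
    rewrite lee_fin; apply: ge0_ler_powR; rewrite ?nnegrE; [lra|lra| |].
      by rewrite mulr_ge0// ltW.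
    by apply: (le_trans k2); rewrite exprS /l; lra.
  apply: ge0_le_integral; [exact: measurableT| | | |].
  - by move=> x _; case: ifP => // _; exact: poweR_ge0.
  - apply: measurable_fun_ifT; [|apply: (measurableT_comp (measurable_poweR _))
    |exact: measurable_cst].
      by apply: measurable_fun_lte; [exact: measurable_cst|exact: measurable_qmax].
    exact: measurable_qmax.
  - apply: ge0_emeasurable_sum => [k x _ _|k _]; first exact: t0.
    exact: measurable_funeM.
  move=> x _; case: ifPn => [em|_]; last by apply: nneseries_ge0 => k _ _; exact: t0.
  case mE : (qmax F x) => [m| |]; rewrite mE in em.
  - by rewrite poweR_EFin; apply: H; rewrite ?mE//; rewrite lte_fin in em.
  - rewrite poweRyr ?gt_eqF// leye_eq; apply/eqP/eq_infty => A.
    pose y : R := (Num.max A (Num.max 1 (2 * e + 1)))%R.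
    apply: (@le_trans _ _ (y `^ q)%:E); last first.
      by apply: H; rewrite ?mE ?leey// !lt_max; apply/orP; right; apply/orP; right; lra.
    rewrite lee_fin; apply: (@le_trans _ _ y); first by rewrite le_max lexx.
    by apply: le1r_powR; [rewrite !le_max lexx !orbT|exact: ltW].
  - by rewrite ltNge leNye in em.
rewrite integral_nneseries; [|exact: measurableT| |]; last 2 first.
- by move=> k; apply: measurable_funeM; exact: mind.
- by move=> k x _; rewrite -EFinM lee_fin mulr_ge0 ?powR_ge0.
apply: (@le_trans _ _ (\sum_(k <oo) \int[mu]_x ((4 `^ q * C * l k `^ (q - 1))%:E * cutoff F
  (l k) x))).
  apply: lee_nneseries => [k _ _|k _].
    by apply: integral_ge0 => x _; rewrite -EFinM lee_fin mulr_ge0 ?powR_ge0.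
  rewrite ge0_integralZl; [|exact: measurableT|exact: mind|by move=> x _;
    rewrite lee_fin|by rewrite lee_fin powR_ge0].
  rewrite integral_indic; [|exact: measurableT|exact: measurable_lt_qmax].
  rewrite setIT ge0_integralZl; [|exact: measurableT| | |]; last 3 first.
  - exact: measurable_cutoff.
  - by move=> x _; exact: cutoff_ge0.
  - by rewrite lee_fin !mulr_ge0 ?powR_ge0// ltW.
  have -> : ((4 * l k) `^ q = 4 `^ q * l k `^ (q - 1) * l k)%R.
    by rewrite powRM// ?(ltW (l0 k))// -mulrA [(_ * l k)%R]mulrC mulr_powRB1// ltW.
  rewrite EFinM -muleA mulrAC [(_ * C)%:E]EFinM -muleA lee_wpmul2l//.
    by rewrite lee_fin mulr_ge0 ?powR_ge0.
  exact: qmax_weak_cutoff.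
rewrite -integral_nneseries; [|exact: measurableT| |]; last 2 first.
- by move=> k; apply: measurable_funeM; exact: measurable_cutoff.
- by move=> k x _; rewrite mule_ge0 ?cutoff_ge0// lee_fin !mulr_ge0 ?powR_ge0// ltW.
rewrite -ge0_integralZl; [|exact: measurableT| | |]; last 3 first.
- by apply: (measurableT_comp (measurable_poweR _)); exact: mF.
- by move=> x _; exact: poweR_ge0.
- by rewrite lee_fin !mulr_ge0 ?powR_ge0 ?invr_ge0 ?ltW//; lra.
have t0 k x : 0 <= (4 `^ q * C * l k `^ (q - 1))%:E * cutoff F (l k) x.
  by rewrite mule_ge0 ?cutoff_ge0// lee_fin !mulr_ge0 ?powR_ge0// ltW.
apply: ge0_le_integral; [exact: measurableT| | | |].
- by move=> x _; apply: nneseries_ge0 => k _ _; exact: t0.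
- apply: ge0_emeasurable_sum => [k x _ _|k _]; first exact: t0.
  by apply: measurable_funeM; exact: measurable_cutoff.
- by apply: measurable_funeM; apply: (measurableT_comp (measurable_poweR _)); exact: mF.
move=> x _; have := F0 x; rewrite /cutoff; case FE : (F x) => [y| |] // y0; last first.
  rewrite poweRyr ?gt_eqF// gt0_muley ?leey// lte_fin !mulr_gt0 ?powR_gt0 ?invr_gt0//; lra.
rewrite lee_fin in y0.
apply: lime_le; first by apply: is_cvg_nneseries => k _ _; have := t0 k x; rewrite /cutoff FE.
apply: nearW => N.
rewrite (eq_bigr (fun k => (4 `^ q * C * y * (if l k < y then l k `^ (q - 1) else 0))%:E));
  last first.
  move=> k _; rewrite lte_fin; case: ifP => _; first by rewrite -EFinM; congr EFin; ring.
  by rewrite mule0 mulr0.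
rewrite sumEFin -mulr_sumr poweR_EFin -EFinM lee_fin -!mulrA ler_pM2l ?powR_gt0// ler_pM2l//.
have := dyadic_sum_le (q - 1) e y N r0 e0 y0; rewrite -ler_pdivlMr; last by lra.
move=> h; rewrite -[in leRHS](mulr_powRB1 y0 q0) [leRHS](_ : _ = y * ((2 * y) `^ (q - 1) / (2
  `^ (q - 1) - 1)))%R; last first.
  by rewrite powRM//; ring.
rewrite ler_wpM2l//; apply: (le_trans h); rewrite ler_pM2r ?invr_gt0; last lra.
apply: ge0_ler_powR; rewrite ?nnegrE ?(ltW r0)//.
- by rewrite le_min (ltW (l0 _)) mulr_ge0.
- by rewrite mulr_ge0.
- by rewrite ge_min lexx orbT.
Qed.

End maximal_theorem_strong.

Section maximal_theorem_final.
Context {R : realType} {n : nat}.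
Local Notation E := (euclid R n).
Local Notation mu := (@lebesgue R n : {measure set E -> \bar R}).
Local Open Scope ereal_scope.
Implicit Types (F H : E -> \bar R).

Lemma qmax_ge0 F x : (forall x, 0 <= F x) -> 0 <= qmax F x.
Proof.
move=> F0; have [k xk _] := eball_sub_qball x 1 ltr01.
apply: le_trans (avg_ge0 F k F0) _; apply: ereal_sup_ubound; exists k => //.
by apply: xk; exact: eball_center.
Qed.

(** The constant of [qmax_strong_trunc] does not depend on e, which can
    therefore be sent to 0. *)
Lemma qmax_strong (q : R) : (1 < q)%R -> exists2 C : R, (0 <= C)%R &
  forall F, measurable_fun setT F -> (forall x, 0 <= F x) ->
    \int[mu]_x (qmax F x) `^ q <= C%:E * \int[mu]_x (F x) `^ q.
Proof.
move=> q1; set C := (4 `^ q * @doubling_const R n * (2 `^ (q - 1) / (2 `^ (q - 1) - 1)))%R.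
have x1 : (1 < 2 `^ (q - 1) :> R)%R.
  have r0 : (0 < q - 1)%R by lra.
  have := @gt0_ltr_powR R _ r0 1%R 2%R; rewrite powR1; apply; rewrite ?nnegrE; lra.
exists C.
  rewrite !mulr_ge0 ?powR_ge0// ?exprn_ge0 ?mulr_ge0// invr_ge0; lra.
move=> F mF F0.
pose g (j : nat) x : \bar R :=
  if (2 * (2 ^+ j)^-1)%:E < qmax F x then (qmax F x) `^ q else 0.
have mg j : measurable_fun setT (g j).
  apply: measurable_fun_ifT; [|apply: (measurableT_comp (measurable_poweR _))
    |exact: measurable_cst].
    by apply: measurable_fun_lte; [exact: measurable_cst|exact: measurable_qmax].
  exact: measurable_qmax.
have g0 j x : 0 <= g j x by rewrite /g; case: ifP => // _; exact: poweR_ge0.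
have ndg x : {homo g^~ x : i j / (i <= j)%N >-> i <= j}.
  move=> i j ij; rewrite /g; case: ifPn => [mi|_]; last exact: g0.
  rewrite ifT//; apply: le_lt_trans mi.
  by rewrite lee_fin ler_pM2l// lef_pV2 ?posrE ?exprn_gt0// ler_eXn2l// ltr1n.
have gE x : limn (g^~ x) = (qmax F x) `^ q.
  apply: cvg_lim => //; apply: cvg_near_cst.
  have m0 := qmax_ge0 F x F0.
  case mE : (qmax F x) m0 => [m| |] // m0; last first.
    by apply: nearW => j; rewrite /g mE ltry.
  rewrite lee_fin le_eqVlt in m0; case/predU1P : m0 => [m0|m0].
    apply: nearW => j; rewrite /g mE -m0 poweR_EFin powR0 ?gt_eqF//; last lra.
    by case: ifP.
  exists (Num.bound (2 / m)) => // j /= jb; rewrite /g mE ifT// lte_fin.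
  rewrite ltr_pdivrMr ?exprn_gt0// mulrC -ltr_pdivrMr//.
  apply: lt_le_trans (archi_boundP _) _; first by rewrite divr_ge0// ltW.
  rewrite -natrX ler_nat; apply: leq_trans jb _.
  by rewrite ltnW// ltn_expl.
rewrite (_ : \int[mu]_x _ = \int[mu]_x limn (g^~ x)); last first.
  by apply: eq_integral => x _; rewrite gE.
rewrite monotone_convergence; [|exact: measurableT|exact: mg|by move=> j x _;
  exact: g0|by move=> x _; exact: ndg].
apply: lime_le.
  apply: ereal_nondecreasing_is_cvgn => i j ij.
  apply: ge0_le_integral; [exact: measurableT|by move=> x _; exact: g0|exact: mg|exact: mg|].
  by move=> x _; exact: ndg.
by apply: nearW => j; exact: qmax_strong_trunc.
Qed.

End maximal_theorem_final.

(** * Almost increasing functions *)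

Section almost_increasing.
Context {R : realType}.
Local Open Scope ereal_scope.
Implicit Types (u : R -> \bar R) (p q a c t s : R).

(** (aInc)_q in ratio form.  Keeping [u] undivided avoids products of powers
    with infinite values, and makes a smaller exponent a weaker condition
    at once since t / s <= 1. *)
Definition ainc u q a c : Prop := forall t s, (c < t)%R -> (t <= s)%R ->
  u t <= (a * (t / s) `^ q)%:E * u s.

Lemma ratio_itv t s : (0 < t)%R -> (t <= s)%R -> (0 < t / s <= 1)%R.
Proof.
move=> t0 ts; have s0 := lt_le_trans t0 ts.
by rewrite divr_gt0//= ler_pdivrMr// mul1r.
Qed.

Lemma ainc_exponent u p q a c : (0 <= c)%R -> (0 <= a)%R -> (q <= p)%R ->
  (forall t, (0 <= t)%R -> 0 <= u t) -> ainc u p a c -> ainc u q a c.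
Proof.
move=> c0 a0 qp u0 H t s ct ts; apply: (le_trans (H t s ct ts)).
have t0 := le_lt_trans c0 ct.
apply: lee_wpmul2r; first by rewrite u0// (le_trans (ltW t0)).
by rewrite lee_fin ler_wpM2l// ger_powR// ratio_itv.
Qed.

(** Between c and t0 + 1 + c the ratio t / s is bounded below, and there
    monotonicity is as good as (aInc)_q. *)
Lemma ainc_extend u q a t0 c : (0 < c)%R -> (0 <= t0)%R -> (1 <= a)%R -> (0 <= q)%R ->
  (forall t, (0 <= t)%R -> 0 <= u t) ->
  (forall t s, (0 <= t)%R -> (t <= s)%R -> u t <= u s) ->
  ainc u q a t0 -> ainc u q (a * ((t0 + 1 + c) / c) `^ q) c.
Proof.
move=> c0 t00 a1 q0 u0 um H t s ct ts.
have t_0 := lt_trans c0 ct; have s0 := lt_le_trans t_0 ts.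
have us0 : 0 <= u s by rewrite u0// ltW.
set t1 := (t0 + 1 + c)%R.
have t1c : (1 <= t1 / c)%R by rewrite ler_pdivlMr// /t1; lra.
have k1 : (1 <= (t1 / c) `^ q)%R.
  by rewrite -(powRr0 (t1 / c)) ler_powR.
have [/andP[r0 r1]] := ratio_itv t s t_0 ts.
have rq0 : (0 <= (t / s) `^ q)%R by exact: powR_ge0.
have [tt0|tt0] := ltP t0 t.
  apply: (le_trans (H t s tt0 ts)); apply: lee_wpmul2r => //.
  by rewrite lee_fin ler_wpM2r// ler_peMr//; lra.
have [st1|st1] := leP s t1.
  apply: (le_trans (um t s (ltW t_0) ts)).
  rewrite -[leLHS]mul1e; apply: lee_wpmul2r => //.
  rewrite lee_fin -mulrA -powRM ?(ltW r0)//; last by rewrite divr_ge0// ?ltW// /t1; lra.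
  apply: (@le_trans _ _ (a * 1)%R); first by rewrite mulr1.
  apply: ler_wpM2l; first lra.
  rewrite -[leLHS](powRr0 (t1 / c * (t / s))); apply: ler_powR => //.
  rewrite mulf_div ler_pdivlMr ?mulr_gt0// mul1r [leLHS]mulrC.
  by apply: ler_pM => //; exact: ltW.
apply: (@le_trans _ _ (u t1)); first by apply: um; rewrite ?ltW// /t1; lra.
have t01 : (t0 < t1)%R by rewrite /t1; lra.
apply: (le_trans (H t1 s t01 (ltW st1))); apply: lee_wpmul2r => //.
have t10 : (0 < t1)%R by rewrite /t1; lra.
rewrite lee_fin -mulrA; apply: ler_wpM2l; first lra.
rewrite -powRM ?(ltW r0)//; last by rewrite divr_ge0// ltW.
apply: ge0_ler_powR; rewrite ?nnegrE//.
- by rewrite divr_ge0// ltW.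
- by rewrite mulr_ge0 ?(ltW r0)// divr_ge0// ltW.
rewrite mulrA ler_pM2r ?invr_gt0// -mulrA ler_peMr ?(ltW t10)//.
by rewrite mulrC ler_pdivlMr// mul1r ltW.
Qed.

End almost_increasing.

Section ae_tools.
Context {R : realType} {n : nat}.
Local Notation E := (euclid R n).
Local Notation mu := (@lebesgue R n : {measure set E -> \bar R}).

Lemma ae_forall_countable (I : countType) (P : I -> E -> Prop) :
  (forall i, \forall x \ae mu, P i x) -> \forall x \ae mu, forall i, P i x.
Proof.
move=> H.
have : \forall x \ae mu, forall k : nat, forall i, unpickle k = Some i -> P i x.
  apply: ae_foralln => k; case: (@unpickle I k) => [i|].
    by apply: filterS (H i) => x Pix j [<-].
  by apply: aeW => x j.
by apply: filterS => x Hx i; apply: (Hx (pickle i)); rewrite pickleK.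
Qed.

End ae_tools.

Section uniform_ainc.
Context {R : realType} {n : nat}.
Local Notation E := (euclid R n).
Local Notation mu := (@lebesgue R n : {measure set E -> \bar R}).
Context {Omega : set E} {phi : E -> R -> \bar R}.
Context (wphi : weak_Phi Omega phi).
Local Open Scope ereal_scope.

Lemma phi_ge0 x t : Omega x -> (0 <= t)%R -> 0 <= phi x t.
Proof. by case: wphi => h _ _ _ _; exact: h. Qed.

Lemma phi_le x s t : Omega x -> (0 <= s)%R -> (s <= t)%R -> phi x s <= phi x t.
Proof. by case: wphi => _ _ h _ _; exact: h. Qed.

Lemma phi0 x : Omega x -> phi x 0 = 0.
Proof. by case: wphi => _ _ _ h _ /h[]. Qed.

Lemma phi_unbounded x (A : R) : Omega x -> exists2 t, (0 < t)%R & A%:E < phi x t.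
Proof.
case: wphi => _ _ _ h _ /h[_ _ /cvgeyPgt/(_ A)[M [_ HM]]].
exists (Num.max 1 (M + 1))%R; first by rewrite lt_max ltr01.
by apply: HM; rewrite lt_max ltrDl ltr01 orbT.
Qed.

(** The form in which almost increase of phi(x, t) / t is used. *)
Lemma phi_scale : exists2 L : R, (1 <= L)%R & forall x l t, Omega x ->
  (0 < l)%R -> (l <= 1)%R -> (0 <= t)%R -> phi x (l * t)%R <= (L * l)%:E * phi x t.
Proof.
case: wphi => _ _ _ _ [L L1 HL]; exists L => // x l t Ox l0 l1 t0.
have p0 := phi_ge0 x t Ox t0.
move: t0; rewrite le_eqVlt => /predU1P[<-|t0]; first by rewrite mulr0 phi0// mule0.
move: l1; rewrite le_eqVlt => /predU1P[->|l1].
  by rewrite mulr1 mul1r -[leLHS]mul1e; apply: lee_wpmul2r.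
have lt0 : (0 < l * t)%R by rewrite mulr_gt0.
have ltt : (l * t < t)%R by rewrite gtr_pMl.
have := HL x (l * t)%R t Ox lt0 ltt; rewrite lee_pdivrMr// => /le_trans; apply.
rewrite (muleC (phi x t)) [leLHS]muleC !muleA -!EFinM.
by rewrite (_ : (l * t * L / t)%R = (L * l)%R)//; field; lra.
Qed.

(** The null set of [aInc] depends on the two arguments.  Rational arguments
    give a common one; real arguments that differ by a factor of at least 4 have
    suitable rationals between them, and for closer ones monotonicity is
    enough. *)
Lemma ae_ainc p A (T : set R) (c : R) : (0 <= c)%R -> (0 <= p)%R ->
  (forall t, (c < t)%R -> T t) -> A `<=` Omega -> aInc phi p A T ->
  exists2 a : R, (1 <= a)%R & \forall x \ae mu, A x -> ainc (phi x) p a c.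
Proof.
move=> c0 p0 cT AO [a a1 Ha].
have p41 : (1 <= 4 `^ p :> R)%R by rewrite -[leLHS](powRr0 4) ler_powR//; lra.
exists (a * 4 `^ p)%R; first by rewrite (le_trans a1)// ler_peMr//; lra.
have : \forall x \ae mu, forall ts : rat * rat, (c < ratr ts.1)%R ->
  (ratr ts.1 < ratr ts.2 :> R)%R ->
    A x -> phi x (ratr ts.1) * ((ratr ts.1) `^ p)^-1%:E <=
      a%:E * (phi x (ratr ts.2) * ((ratr ts.2) `^ p)^-1%:E).
  apply: ae_forall_countable => -[t s] /=.
  have [ct|] := pselect (c < ratr t)%R; last by move=> ct; apply: aeW.
  have [ts|] := pselect (ratr t < ratr s :> R)%R; last by move=> ts; apply: aeW.
  have t0 := le_lt_trans c0 ct.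
  have := Ha _ _ (cT _ ct) (cT _ (lt_trans ct ts)) t0 ts.
  by apply: filterS => x Hx _ _ /Hx.
apply: filterS => x Hx Ax t s ct ts.
have Ox := AO _ Ax; have t0 := le_lt_trans c0 ct; have s0 := lt_le_trans t0 ts.
have ps0 : 0 <= phi x s by apply: phi_ge0 => //; exact: ltW.
have [/andP[r0 r1]] := ratio_itv t s t0 ts.
have [s4|s4] := ltP s (4 * t)%R.
  apply: (le_trans (phi_le x t s Ox (ltW t0) ts)).
  rewrite -[leLHS]mul1e; apply: lee_wpmul2r => //.
  rewrite lee_fin -mulrA -powRM//; last exact: ltW.
  apply: (@le_trans _ _ (a * 1)%R); first by rewrite mulr1.
  apply: ler_wpM2l; first lra.
  rewrite -[leLHS](powRr0 (4 * (t / s))%R); apply: ler_powR => //.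
  by rewrite mulrA ler_pdivlMr// mul1r ltW.
have [t' t't] : exists t' : rat, (t < ratr t' < 2 * t)%R.
  have : (t < 2 * t)%R by lra.
  by move=> /rat_in_itvoo[t']; rewrite in_itv/=; exists t'.
have [s' s's] : exists s' : rat, (s / 2 < ratr s' < s)%R.
  have : (s / 2 < s)%R by lra.
  by move=> /rat_in_itvoo[s']; rewrite in_itv/=; exists s'.
move: t't s's => /andP[tt' t't] /andP[ss' s's].
have ct' : (c < ratr t')%R by lra.
have ts' : (ratr t' < ratr s' :> R)%R by lra.
have t'0 : (0 < ratr t' :> R)%R by lra.
have s'0 : (0 < ratr s' :> R)%R by lra.
have := Hx (t', s') ct' ts' Ax => /=.
rewrite lee_pdivrMr ?powR_gt0// => h.
apply: (le_trans (phi_le x t _ Ox (ltW t0) (ltW tt'))); apply: (le_trans h).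
rewrite -muleA muleAC -muleA muleA muleC -!muleA.
have ps'0 : 0 <= phi x (ratr s') by apply: phi_ge0 => //; exact: ltW.
apply: (@le_trans _ _ ((a * 4 `^ p * (t / s) `^ p)%:E * phi x (ratr s'))); last first.
  apply: lee_wpmul2l; first by rewrite lee_fin !mulr_ge0 ?powR_ge0//; lra.
  by apply: phi_le => //; exact: ltW.
rewrite !muleA -!EFinM; apply: lee_wpmul2r => //; rewrite lee_fin.
rewrite mulrC -[leRHS]mulrA; apply: ler_wpM2l; first lra.
have k0 : (0 <= 4 * (t / s))%R by rewrite mulr_ge0// ltW.
have k1 : (0 <= 4 * (t / s) * ratr s')%R by apply: mulr_ge0 => //; exact: ltW.
rewrite ler_pdivrMr; last exact: powR_gt0.
rewrite -powRM ?(ltW r0)// -powRM ?(ltW s'0)//.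
apply: ge0_ler_powR; rewrite ?nnegrE ?(ltW t'0)//.
apply: (le_trans (ltW t't)).
have -> : (2 * t = 4 * (t / s) * (s / 2))%R by field; lra.
by apply: ler_wpM2l => //; exact: ltW.
Qed.

End uniform_ainc.

(** * Uniform forms of the structural conditions *)

Section structure_conditions.
Context {R : realType} {n : nat}.
Local Notation E := (euclid R n).
Local Notation mu := (@lebesgue R n : {measure set E -> \bar R}).
Context {Omega : set E} {phi : E -> R -> \bar R}.
Context (wphi : weak_Phi Omega phi).
Local Open Scope ereal_scope.

(** The inverse at level 1 lies between beta and 1 / beta, so phi is below 1 at
    beta / 2 and at least 1 at 2 / beta. *)
Lemma A0_bounds : A0 Omega phi -> exists b T : R, [/\ (0 < b)%R, (b < T)%R &
  \forall x \ae mu, Omega x -> phi x b < 1 /\ 1 <= phi x T].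
Proof.
move=> [beta [beta0 beta1 H]]; exists (beta / 2)%R, (2 / beta)%R; split.
- by rewrite divr_gt0.
- apply: (@lt_le_trans _ _ 1%R); first lra.
  by rewrite ler_pdivlMr//; lra.
apply: filterS H => x Hx Ox; have /andP[h1 h2] := Hx Ox; split.
  rewrite ltNge; apply/negP => h3; move: h1; rewrite leNgt => /negP; apply.
  apply: (@le_lt_trans _ _ (beta / 2)%:E); last by rewrite lte_fin; lra.
  apply: ereal_inf_lbound; exists (beta / 2)%R => //; split => //.
  by rewrite divr_ge0// ltW.
have : gen_inverse phi x 1 < (2 / beta)%:E.
  apply: (le_lt_trans h2); rewrite lte_fin -[ltLHS]mul1r ltr_pM2r ?invr_gt0//; lra.
move=> /ereal_inf_lt[_ [tau [tau0 h] <-]]; rewrite lte_fin => tauT.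
by apply: (le_trans h); apply: (phi_le wphi) => //; exact: ltW.
Qed.

(** Exchanging the points in a statement with nested almost-everywhere
    quantifiers.  For fixed tau, one single good z with phi(z, tau) < t gives
    phi(x, be tau) < t outside a null set of x that serves all other z as
    well.  Only countably many tau can be treated in this way; a rational
    tau replaces a real one at the cost of the factor 2. *)
Lemma ae_swap (D : set E) (be : R) (t : \bar R) : (0 < be)%R -> D `<=` Omega ->
  (\forall x \ae mu, \forall y \ae mu, D x -> D y ->
     forall tau : R, (0 < tau)%R -> phi x tau < t -> phi y (be * tau)%R < t) ->
  \forall x \ae mu, \forall y \ae mu, D x -> D y ->
     forall tau : R, (0 < tau)%R -> phi y tau < t -> phi x (be / 2 * tau)%R < t.
Proof.
move=> be0 DO H.
pose good z := \forall y \ae mu, D z -> D y ->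
  forall tau : R, (0 < tau)%R -> phi z tau < t -> phi y (be * tau)%R < t.
have : \forall x \ae mu, forall r : rat, (0 < r)%R -> D x ->
    (exists z, [/\ good z, D z & phi z (ratr r) < t]) -> phi x (be * ratr r)%R < t.
  apply: ae_forall_countable => r.
  have [[z [gz Dz zr]]|no] := pselect (exists z, [/\ good z, D z & phi z (ratr r) < t]).
    apply: filterS gz => x gz r0 Dx _.
    by apply: gz => //; rewrite ltr0q.
  by apply: aeW => x _ _ /no.
apply: filterS => x Hx; apply: filterS H => y gy Dx Dy tau tau0 ytau.
have [r /andP[r1 r2]] : exists r : rat, (tau / 2 < ratr r < tau)%R.
  have : (tau / 2 < tau)%R by lra.
  by move=> /rat_in_itvoo[r]; rewrite in_itv/=; exists r.
have r0 : (0 < r)%R by rewrite -(ltr0q R); lra.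
have rr0 : (0 < ratr r :> R)%R by rewrite ltr0q.
apply: (@le_lt_trans _ _ (phi x (be * ratr r)%R)).
  apply: (phi_le wphi); first exact: DO.
    by rewrite !mulr_ge0 ?invr_ge0// ltW.
  by rewrite -mulrA ler_pM2l//; lra.
apply: Hx => //; exists y; split => //.
by apply: le_lt_trans ytau; apply: (phi_le wphi); [exact: DO|exact: ltW|exact: ltW].
Qed.

(** Condition A1 without inverses: a level t = 2^j not reached by phi(y, tau) is
    not reached by phi(x, be tau) either. *)
Lemma A1_uniform : A1 Omega phi -> exists2 be : R, (0 < be < 1)%R &
  \forall x \ae mu, forall kj : nat * nat,
    mu (qball kj.1) <= 1 -> (2 ^+ kj.2 <= (fine (mu (qball kj.1)))^-1)%R ->
    \forall y \ae mu, (qball kj.1 `&` Omega) x -> (qball kj.1 `&` Omega) y ->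
      forall tau : R, (0 < tau)%R ->
      phi y tau < (2 ^+ kj.2)%:E -> phi x (be * tau)%R < (2 ^+ kj.2)%:E.
Proof.
move=> [beta [beta0 beta1 H]]; exists (beta / 2 / 2)%R.
  by apply/andP; split; [rewrite !divr_gt0|lra].
apply: ae_forall_countable => -[k j] /=.
have [k1|] := pselect (mu (@qball R n k) <= 1); last by move=> k1; apply: aeW.
have [jk|] := pselect (2 ^+ j <= (fine (mu (@qball R n k)))^-1)%R; last by move=> jk;
  apply: aeW.
have t1 : (1 <= (2 ^+ j : R) <= (fine (mu (@qball R n k)))^-1)%R.
  by apply/andP; split; [apply: exprn_ege1; rewrite ler1n|exact: jk].
have := H _ _ (rat_ball_gt0 k) k1 _ t1.
move=> {}H.
have b20 : (0 < beta / 2)%R by rewrite divr_gt0.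
suff : \forall x \ae mu, \forall y \ae mu, (qball k `&` Omega) x -> (qball k `&` Omega) y ->
    forall tau : R, (0 < tau)%R -> phi x tau < (2 ^+ j)%:E ->
      phi y (beta / 2 * tau)%R < (2 ^+ j)%:E.
  by move=> /(ae_swap _ _ _ b20 (@subIsetr _ _ _)); apply: filterS => x Hx _ _.
apply: filterS H => x; apply: filterS => y h Dx Dy tau tau0 xt.
have h1 : tau%:E <= gen_inverse phi x (2 ^+ j).
  apply: le_ereal_inf_tmp => _ [r [r0 tr] <-]; rewrite lee_fin leNgt.
  apply/negP => rtau; move: xt; rewrite ltNge => /negP; apply; apply: (le_trans tr).
  by apply: (phi_le wphi) => //; [case: Dx|exact: ltW].
rewrite ltNge; apply/negP => yt.
have h2 : gen_inverse phi y (2 ^+ j) <= (beta / 2 * tau)%:E.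
  by apply: ereal_inf_lbound; exists (beta / 2 * tau)%R => //; split => //=;
    rewrite mulr_ge0 ?ltW.
have := le_trans (h Dx Dy) h2.
apply/negP; rewrite -ltNge; apply: (@lt_le_trans _ _ (beta%:E * tau%:E)).
  by rewrite -EFinM lte_fin ltr_pM2r//; lra.
by apply: lee_wpmul2l => //; rewrite lee_fin ltW.
Qed.

Lemma exists_small_value (Q : set E) (h : E -> R) (A : set E) (e : R) :
  measurable A -> measurable_fun A h -> (forall x, (0 <= h x)%R) ->
  \int[mu]_(x in A) (h x)%:E < +oo -> mu A = +oo ->
  (\forall x \ae mu, Q x) -> (0 < e)%R -> exists x, [/\ A x, Q x & (h x <= e)%R].
Proof.
move=> mA mh h0 hfin Aoo aeQ e0; apply: contrapT => no.
have : \int[mu]_(x in A) e%:E <= \int[mu]_(x in A) (h x)%:E.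
  apply: ae_ge0_le_integral; [exact: mA|by move=> x _;
    rewrite lee_fin ltW|exact: measurable_cst|
    by move=> x _; rewrite lee_fin|exact/measurable_EFinP|].
  apply: filterS aeQ => x Qx Ax; rewrite lee_fin leNgt; apply/negP => hx.
  by apply: no; exists x; split => //; exact: ltW.
rewrite integral_cst// Aoo gt0_muley ?lte_fin// => /le_lt_trans/(_ hfin).
by rewrite ltxx.
Qed.

(** Condition A2 with arguments rescaled to the interval [0, T], where both of
    its smallness conditions hold, and with (aInc)_q for the comparison function chi.
    That property is inherited from phi(y, .) at points y outside G where
    h(y) is small; such points exist if Omega has infinite measure, and
    otherwise chi = 0 and h = 1 satisfy all requirements. *)
Lemma A2_two_sided (G : set E) (q T b : R) : measurable Omega ->
  (1 < q)%R -> (0 < b)%R -> (b < T)%R ->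
  A2 Omega phi -> measurable G -> mu G < +oo ->
  (\forall x \ae mu, Omega x -> phi x b < 1) ->
  (exists2 a, (1 <= a)%R & \forall x \ae mu, (Omega `\` G) x -> ainc (phi x) q a 0) ->
  exists (chi : R -> R) (h : E -> R) (c a : R),
  [/\ [/\ (0 < c)%R, (c <= 1)%R & (1 <= a)%R],
      [/\ measurable_fun Omega h, (forall x, (0 <= h x)%R) &
        \int[mu]_(x in Omega) (h x)%:E < +oo],
      [/\ (forall t, (0 <= t <= T)%R -> (0 <= chi t)%R) &
       (forall s t, (0 < s)%R -> (s <= t)%R -> (t <= T)%R ->
         (chi s <= a * (s / t) `^ q * chi t)%R)] &
      \forall x \ae mu, Omega x -> forall t, (0 <= t <= T)%R ->
       (chi t)%:E <= phi x t + (h x)%:E /\ phi x (c * t)%R <= (chi t)%:E + (h x)%:E].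
Proof.
move=> mO q1 b0 bT A2h mG Gfin Hb [a0 a01 Hainc].
have T0 : (0 < T)%R by exact: lt_trans bT.
have q0 : (0 <= q)%R := le_trans ler01 (ltW q1).
have [Ofin|] := boolP (mu Omega < +oo).
  exists (fun=> 0%R), (fun=> 1%R), (b / T)%R, 1%R; split; [split| | |].
  - by rewrite divr_gt0.
  - by rewrite ler_pdivrMr// mul1r ltW.
  - by [].
  - by split; [exact: measurable_cst|by []|rewrite integral_cst// mul1e].
  - by split => // s t _ _ _; rewrite mulr0.
  apply: filterS Hb => x Hx Ox t /andP[t0 tT]; split.
    by rewrite adde_ge0// ?lee_fin//; apply: (phi_ge0 wphi).
  rewrite add0e; apply: le_trans (ltW (Hx Ox)); apply: (phi_le wphi) => //.
    by rewrite !mulr_ge0 ?invr_ge0// ltW.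
  by rewrite mulrAC ler_pdivrMr// ler_pM2l.
rewrite -leNgt leye_eq => /eqP Ooo.
have [poo [h [be [s [wpoo [ih _] /andP[be0 be1] s0 HA2]]]]] := A2h.
have [L L1 Hscale] := phi_scale wphi.
(* small arguments keep [phi] below [s] *)
pose l : R := Num.min 1%R (s / L)%R.
have L0 : (0 < L)%R := lt_le_trans ltr01 L1.
have l0 : (0 < l)%R by rewrite lt_min ltr01 divr_gt0.
have l1 : (l <= 1)%R by rewrite ge_min lexx.
have lL : (L * l <= s)%R by rewrite mulrC -ler_pdivlMr// ge_min lexx orbT.
have [t1 t10 poot1] : exists2 t1, (0 < t1)%R & poo t1 <= s%:E.
  have [_ _ _ /(_ 0%R I)[_ Hcvg _] _] := wpoo.
  have s0' : 0 < s%:E by rewrite lte_fin.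
  have Hn : \forall t \near 0%R^'+, poo t < s%:E by exact: (Hcvg _ (open_ereal_lt' s0')).
  have [t [t0 ts]] := filter_ex (filterI (nbhs_right_gt 0%R) Hn).
  by exists t => //; exact: ltW.
(* [c3 * t] stays below [t1], and below [be] times an argument at which
   [phi <= s], so both implications of A2 apply *)
pose c3 : R := (Num.min (be * l * b) t1 / T)%R.
have blb0 : (0 < be * l * b)%R by rewrite !mulr_gt0.
have c30 : (0 < c3)%R by rewrite divr_gt0// lt_min blb0.
have lb : (l * b <= b)%R by rewrite ler_piMl// ltW.
have blb : (be * l * b <= b)%R by rewrite -mulrA; apply: le_trans lb;
  rewrite ler_piMl// mulr_ge0// ltW.
have c31 : (c3 <= 1)%R.
  by rewrite ler_pdivrMr// mul1r ge_min; apply/orP; left; apply: (le_trans blb); exact: ltW.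
have c3t t : (0 <= t <= T)%R -> (0 <= c3 * t <= t1)%R /\ (c3 * t <= be * (l * b / T * t))%R.
  move=> /andP[t0 tT]; split.
    rewrite mulr_ge0 ?(ltW c30)//= mulrAC ler_pdivrMr//.
    by rewrite ler_pM// ?ge_min ?lexx ?orbT// le_min (ltW blb0) ltW.
  rewrite !mulrA ler_wpM2r// ler_pM2r ?invr_gt0//.
  by rewrite ge_min lexx.
have poole t : (0 <= t <= T)%R -> 0 <= poo (c3 * t)%R <= s%:E.
  move=> tT; have [/andP[h1 h2] _] := c3t t tT.
  by rewrite (phi_ge0 wpoo 0%R)//=; apply: le_trans poot1; exact: (phi_le wpoo 0%R).
pose chi t : R := fine (poo (c3 * t)%R).
have chiE t : (0 <= t <= T)%R -> (chi t)%:E = poo (c3 * t)%R.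
  move=> tT; have /andP[h1 h2] := poole t tT; rewrite /chi fineK// ge0_fin_numE//.
  by apply: (le_lt_trans h2); rewrite ltry.
have chi0 t : (0 <= t <= T)%R -> (0 <= chi t)%R.
  by move=> tT; rewrite -lee_fin chiE//; case/andP: (poole t tT).
have chile s' t : (0 <= s')%R -> (s' <= t)%R -> (t <= T)%R -> (chi s' <= chi t)%R.
  move=> s'0 s't tT.
  have h1 : (0 <= s' <= T)%R by rewrite s'0 (le_trans s't).
  have h2 : (0 <= t <= T)%R by rewrite tT (le_trans s'0).
  rewrite -lee_fin !chiE//; apply: (phi_le wpoo 0%R) => //.
    by case: (c3t s' h1) => /andP[].
  by rewrite ler_pM2l.
have [mh hfin] : measurable_fun Omega h /\ \int[mu]_(x in Omega) `|(h x)%:E| < +oo.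
  by move/integrableP : ih => [/measurable_EFinP].
pose h' x : R := `|h x|%R.
have mh' : measurable_fun Omega h'.
  by apply: (measurableT_comp (@normr_measurable R setT)).
have h'0 x : (0 <= h' x)%R by exact: normr_ge0.
have h'fin : \int[mu]_(x in Omega) (h' x)%:E < +oo by exact: hfin.
pose c := (be * c3)%R.
have c0 : (0 < c)%R by rewrite mulr_gt0.
have c1 : (c <= 1)%R by apply: mulr_ile1 => //; exact: ltW.
have two : \forall x \ae mu, Omega x -> forall t, (0 <= t <= T)%R ->
       (chi t)%:E <= phi x t + (h' x)%:E /\ phi x (c * t)%R <= (chi t)%:E + (h' x)%:E.
  apply: filterS2 Hb HA2 => x Hx HAx Ox t tT; have /andP[t0 tT'] := tT.
  have hh' : (h x)%:E <= (h' x)%:E by rewrite lee_fin ler_norm.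
  have [/andP[ct0 _] ct2] := c3t t tT.
  rewrite chiE//; split; last first.
    have [/(_ (poole t tT)) + _] := HAx Ox (c3 * t)%R ct0.
    by rewrite mulrA => /le_trans; apply; apply: leeD2l.
  have e0 : (0 <= l * b / T * t)%R by rewrite !mulr_ge0 ?invr_ge0// ltW.
  have elb : (l * b / T * t <= l * b)%R.
    by rewrite mulrAC ler_pdivrMr// ler_pM2l// mulr_gt0.
  have et : (l * b / T * t <= t)%R.
    rewrite ler_piMl// ler_pdivrMr// mul1r; apply: (le_trans lb); exact: ltW.
  have es : 0 <= phi x (l * b / T * t)%R <= s%:E.
    rewrite (phi_ge0 wphi)//=; apply: (le_trans (phi_le wphi _ _ _ Ox e0 elb)).
    apply: (le_trans (Hscale x l b Ox l0 l1 (ltW b0))).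
    apply: (@le_trans _ _ ((L * l)%:E * 1)).
      by apply: lee_wpmul2l; [rewrite lee_fin mulr_ge0// ltW|exact: ltW (Hx Ox)].
    by rewrite mule1 lee_fin.
  have [_ /(_ es) H] := HAx Ox _ e0.
  apply: (@le_trans _ _ (poo (be * (l * b / T * t))%R)).
    by apply: (phi_le wpoo 0%R).
  apply: (le_trans H); apply: leeD => //; exact: (phi_le wphi).
have a0' : (0 < a0)%R := lt_le_trans ltr01 a01.
have ic1 : (1 <= c^-1)%R by rewrite invf_ge1.
have icq : (1 <= (c^-1) `^ q)%R by rewrite -[leLHS](powRr0 c^-1) ler_powR.
exists chi, h', c, (a0 * (c^-1) `^ q)%R; split; [|by []| |exact: two].
  by split; [exact: c0|exact: c1|exact: mulr_ege1].
split => // s' t s'0 s't tT.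
have t0 := lt_le_trans s'0 s't.
have s'T : (0 <= s' <= T)%R by rewrite (ltW s'0) (le_trans s't).
have t0T : (0 <= t <= T)%R by rewrite (ltW t0).
have ratE : ((c^-1) `^ q * (s' / t) `^ q = (s' / (c * t)) `^ q)%R.
  rewrite -powRM ?invr_ge0 ?divr_ge0 ?(ltW c0) ?(ltW s'0) ?(ltW t0)//.
  by congr (_ `^ _)%R; field; rewrite !gt_eqF.
(* comparable arguments: monotonicity is enough *)
have [cts|cts] := leP (c * t)%R s'.
  apply: (le_trans (chile _ _ (ltW s'0) s't tT)).
  rewrite ler_peMl ?chi0// -(mulrA a0) ratE; apply: mulr_ege1 => //.
  rewrite -[leLHS](powRr0 (s' / (c * t))); apply: ler_powR; last exact: q0.
  by rewrite ler_pdivlMr ?mul1r// mulr_gt0.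
apply/ler_addgt0Pr => e e0.
have mOG : measurable (Omega `\` G) by exact: measurableD.
pose Q y := (Omega y -> forall t, (0 <= t <= T)%R ->
       (chi t)%:E <= phi y t + (h' y)%:E /\ phi y (c * t)%R <= (chi t)%:E + (h' y)%:E) /\
   ((Omega `\` G) y -> ainc (phi y) q a0 0).
(* the errors [h' y] add up to at most [(a0 + 1) * h' y <= e] *)
have [||||||y [OGy [Q1 Q2] hy]] := @exists_small_value Q h' (Omega `\` G) (e / (a0 + 1)) mOG.
- exact: measurable_funS mh'.
- by [].
- apply: le_lt_trans h'fin; apply: ge0_subset_integral;
  [exact: mOG|exact: mO| | |exact: subDsetl].
  + exact/measurable_EFinP.
  + by move=> x _; rewrite lee_fin.
- apply/eqP; rewrite -leye_eq -Ooo.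
  rewrite leNgt; apply/negP => OGfin.
  have : mu Omega < +oo.
    apply: (@le_lt_trans _ _ (mu G + mu (Omega `\` G))); last by rewrite lte_add_pinfty// -Ooo.
    apply: le_trans (outer_measureU2 (@lebesgue_outer R n) _ _).
    by apply: le_outer_measure => x Ox; have [|] := pselect (G x); [left|right].
  by rewrite Ooo ltxx.
- by apply: filterS2 two Hainc => x h1 h2.
- by rewrite divr_gt0// addr_gt0.
have Oy : Omega y by case: OGy.
have [Hs _] := Q1 Oy s' s'T; have [_ Ht] := Q1 Oy t t0T.
have := Q2 OGy s' (c * t)%R s'0 (ltW cts).
set K : R := (a0 * (s' / (c * t)) `^ q)%R => Hy.
have K0 : (0 <= K)%R by rewrite mulr_ge0 ?powR_ge0// ltW.
have Ka0 : (K <= a0)%R.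
  have ct0 : (0 < c * t)%R by rewrite mulr_gt0.
  rewrite /K ger_pMr// -[leRHS](powRr0 (s' / (c * t))) ger_powR//.
  by apply: ratio_itv => //; exact: ltW.
have KE : (a0 * (c^-1) `^ q * (s' / t) `^ q = K)%R by rewrite -mulrA ratE.
clearbody K.
have : (chi s')%:E <= (K * (chi t + h' y) + h' y)%:E.
  apply: (le_trans Hs); rewrite EFinD; apply: leeD => //; apply: (le_trans Hy).
  by rewrite [leRHS]EFinM; apply: lee_wpmul2l; rewrite ?lee_fin// EFinD.
rewrite KE lee_fin => /le_trans; apply.
rewrite mulrDr -addrA lerD2l.
apply: (@le_trans _ _ ((a0 + 1) * h' y)%R).
  by rewrite mulrDl mul1r lerD2r ler_wpM2r.
by rewrite mulrC -ler_pdivlMr// addr_gt0.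
Qed.

End structure_conditions.

(** * The pointwise estimate of averages *)

Section roots.
Context {R : realType}.
Implicit Types (q a s t x y : R).

Lemma powRVK q x : 0 < q -> 0 <= x -> (x `^ q^-1) `^ q = x.
Proof. by move=> q0 x0; rewrite -powRrM mulVf ?gt_eqF// powRr1. Qed.

Lemma powRKV q x : 0 < q -> 0 <= x -> (x `^ q) `^ q^-1 = x.
Proof. by move=> q0 x0; rewrite -powRrM mulfV ?gt_eqF// powRr1. Qed.

Lemma ler_powR_root q x y : 0 < q -> 0 <= x -> 0 <= y -> x `^ q <= y `^ q -> x <= y.
Proof.
move=> q0 x0 y0 h.
have : (x `^ q) `^ q^-1 <= (y `^ q) `^ q^-1.
  by apply: ge0_ler_powR; rewrite ?nnegrE ?powR_ge0// invr_ge0 ltW.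
by rewrite !powRKV.
Qed.

(** This is (aInc)_q solved for s: if the value at sg is at least t, and the value
    at s is at most H ^ q, then s is at most a multiple of sg H / t^(1/q). *)
Lemma root_bound q a (sg : R) s t (H : \bar R) : 0 < q -> 0 <= t -> 0 < a ->
  0 < sg -> 0 < s -> (0 <= H)%E ->
  (t%:E <= (a * (sg / s) `^ q)%:E * (H `^ q))%E ->
  ((t `^ q^-1 * s)%:E <= (a `^ q^-1 * sg)%:E * H)%E.
Proof.
move=> q0 t0 a0 sg0 s0; case: H => [W| |] //; last first.
  by move=> _ _; rewrite gt0_muley ?leey// lte_fin mulr_gt0// powR_gt0.
rewrite poweR_EFin lee_fin => W0; rewrite -!EFinM !lee_fin => h.
apply: (@ler_powR_root q) => //.
- by rewrite mulr_ge0 ?powR_ge0// ltW.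
- by rewrite !mulr_ge0 ?powR_ge0// ltW.
rewrite !powRM ?powRVK ?mulr_ge0 ?powR_ge0 ?(ltW s0) ?(ltW sg0)// ?(ltW a0)//.
have sq0 : 0 < s `^ q by exact: powR_gt0.
rewrite -ler_pdivlMr//; apply: (le_trans h).
have -> : (sg / s) `^ q = sg `^ q / s `^ q.
  apply: (mulIf (lt0r_neq0 sq0)); rewrite divfK ?gt_eqF// -powRM ?divr_ge0 ?ltW//.
  by rewrite divfK// gt_eqF.
by rewrite mulrA mulrAC.
Qed.

End roots.

Section key_estimate.
Context {R : realType} {n : nat}.
Local Notation E := (euclid R n).
Local Notation mu := (@lebesgue R n : {measure set E -> \bar R}).
Context {Omega : set E} {phi : E -> R -> \bar R}.
Context (wphi : weak_Phi Omega phi).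
Local Open Scope ereal_scope.

Lemma phi_ext_le x (u v : \bar R) : Omega x -> 0 <= u -> u <= v ->
  phi_ext phi x u <= phi_ext phi x v.
Proof.
move=> Ox; case: v => [v| |]; case: u => [u| |] //=; rewrite ?leey//.
by rewrite !lee_fin; exact: (phi_le wphi).
Qed.

Lemma phi_ext_ge0 x (u : \bar R) : Omega x -> 0 <= u -> 0 <= phi_ext phi x u.
Proof. by move=> Ox; case: u => [u| |]//=; rewrite ?leey// lee_fin; exact: (phi_ge0 wphi). Qed.

(** A stand-in for the generalized inverse: tau is within a factor 2 of the
    inverse of phi(x, .) at level t. *)
Lemma level_point x (b t : R) : Omega x -> (0 < b)%R -> phi x b < t%:E ->
  exists tau : R, [/\ (b < tau)%R, t%:E <= phi x tau & phi x (tau / 2)%R < t%:E].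
Proof.
move=> Ox b0 bt.
have exk : exists k, t%:E <= phi x (b * 2 ^+ k)%R.
  have [r r0 tr] := phi_unbounded wphi x t Ox.
  exists (Num.bound (r / b)); apply: (le_trans (ltW tr)).
  apply: (phi_le wphi) => //; first exact: ltW.
  rewrite mulrC -ler_pdivrMr//; apply: ltW.
  apply: lt_le_trans (archi_boundP _) _; first by rewrite divr_ge0// ltW.
  by rewrite -natrX ler_nat ltnW// ltn_expl.
case: (ex_minnP exk) => -[|k].
  by rewrite expr0 mulr1 leNgt bt.
move=> h kmin; exists (b * 2 ^+ k.+1)%R; split => //.
  by rewrite ltr_pMr// exprn_egt1// ltr1n.
rewrite ltNge; apply/negP => h'; have := kmin k; rewrite ltnn => h''.
suff : false by []. by apply: h''; apply: le_trans h' _; rewrite exprSr mulrA mulfK.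
Qed.

Context {q a b T c1 ac be : R} {chi : R -> R} {h : E -> R}.

(** The conditions, with fixed constants, that hold at almost every point. *)
Definition regular x : Prop := [/\ phi x b < 1, 1 <= phi x T,
  ainc (phi x) q a b &
  forall t, (0 <= t <= T)%R ->
    (chi t)%:E <= phi x t + (h x)%:E /\ phi x (c1 * t)%R <= (chi t)%:E + (h x)%:E].

Context (q1 : (1 < q)%R) (a1 : (1 <= a)%R) (b0 : (0 < b)%R) (bT : (b < T)%R).
Context (c10 : (0 < c1)%R) (ac1 : (1 <= ac)%R) (be01 : (0 < be < 1)%R).
Context (h0 : forall x, (0 <= h x)%R).
Context (chi0 : forall t, (0 <= t <= T)%R -> (0 <= chi t)%R).
Context (chi_inc : forall s t, (0 < s)%R -> (s <= t)%R -> (t <= T)%R ->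
  (chi s <= ac * (s / t) `^ q * chi t)%R).

Let q0 : (0 < q)%R := lt_trans ltr01 q1.
Let a0 : (0 < a)%R := lt_le_trans ltr01 a1.
Let ac0 : (0 < ac)%R := lt_le_trans ltr01 ac1.
Let T0 : (0 < T)%R := lt_trans b0 bT.

Definition ainc_root : R := (a `^ q^-1)%R.
(** The constant of [bound_above_chi]; the last summand covers values above T. *)
Definition chi_root : R := (ac `^ q^-1 * (1 + ainc_root * chi T `^ q^-1))%R.

Let ainc_root0 : (0 < ainc_root)%R. Proof. exact: powR_gt0. Qed.
Let chi_root0 : (0 < chi_root)%R.
Proof. by rewrite mulr_gt0 ?powR_gt0// ltr_wpDr// mulr_ge0 ?powR_ge0// ltW. Qed.

(** Either [Fy] is at most sg, or (aInc)_q above sg bounds it by [Hy].  The level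
    stays on the left so that t = 0 causes no division by zero. *)
Lemma bound_above_level y (Fy Hy : \bar R) (sg t : R) : Omega y ->
  ainc (phi y) q a b -> (b < sg)%R -> (0 <= t)%R -> t%:E <= phi y sg ->
  0 <= Fy -> 0 <= Hy -> phi_ext phi y Fy <= Hy `^ q ->
  (t `^ q^-1)%:E * Fy <= (t `^ q^-1 * sg)%:E + (ainc_root * sg)%:E * Hy.
Proof.
move=> Oy inc bsg t0 tphi F0 H0 FH.
have sg0 := lt_trans b0 bsg.
have K0 : (0 < ainc_root * sg)%R by rewrite mulr_gt0.
have p0 : 0 <= (ainc_root * sg)%:E * Hy by rewrite mule_ge0// lee_fin ltW.
case: Fy F0 FH => [s| |]//= s0 FH; last first.
  have -> : Hy = +oo.
    by apply: (@poweR_eqy _ _ q); apply/eqP; rewrite -leye_eq.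
  by rewrite [X in _ + X]gt0_muley ?lte_fin// addey ?leey.
have [ssg|sgs] := leP s sg.
  apply: (@le_trans _ _ (t `^ q^-1 * sg)%:E); last by rewrite leeDl.
  by rewrite -EFinM lee_fin ler_wpM2l// powR_ge0.
have s00 := lt_trans sg0 sgs.
apply: (@le_trans _ _ ((ainc_root * sg)%:E * Hy)); last first.
  by rewrite leeDr// lee_fin mulr_ge0 ?powR_ge0// ltW.
rewrite -EFinM; apply: root_bound => //.
apply: (le_trans tphi); apply: (le_trans (inc _ _ bsg (ltW sgs))).
by apply: lee_wpmul2l => //; rewrite lee_fin mulr_ge0 ?powR_ge0// ltW.
Qed.

(** The same with chi in place of phi.  Since chi is controlled on [0, T]
    only, values of [Fy] above T are bounded through phi, whose level at T is 1, and
    (aInc)_q of chi between sg and T. *)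
Lemma bound_above_chi y (Fy Hy : \bar R) (sg : R) : Omega y ->
  regular y -> (0 < sg)%R -> (sg <= T)%R ->
  0 <= Fy -> 0 <= Hy -> phi_ext phi y Fy + (h y)%:E <= Hy `^ q ->
  (chi sg `^ q^-1)%:E * Fy <= (chi sg `^ q^-1 * sg)%:E + (chi_root * sg)%:E * Hy.
Proof.
move=> Oy [_ phiT inc two] sg0 sgT F0 H0 FhH.
set X : R := (chi sg `^ q^-1)%R.
have X0 : (0 <= X)%R by exact: powR_ge0.
have FH : phi_ext phi y Fy <= Hy `^ q.
  by apply: le_trans FhH; rewrite leeDl// lee_fin.
have K0 : (0 < chi_root * sg)%R by rewrite mulr_gt0.
have p0 : 0 <= (chi_root * sg)%:E * Hy by rewrite mule_ge0// lee_fin ltW.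
case: Fy F0 FH FhH => [s| |]//= s0 FH FhH; last first.
  have -> : Hy = +oo.
    by apply: (@poweR_eqy _ _ q); apply/eqP; rewrite -leye_eq.
  by rewrite [X in _ + X]gt0_muley ?lte_fin// addey ?leey.
have [ssg|sgs] := leP s sg.
  apply: (@le_trans _ _ (X * sg)%:E); last by rewrite leeDl.
  by rewrite -EFinM lee_fin ler_wpM2l.
have s00 := lt_trans sg0 sgs.
have acq0 : (0 < ac `^ q^-1)%R by exact: powR_gt0.
have chiT0 : (0 <= chi T)%R by apply: chi0; rewrite lexx ltW.
have chisg0 : (0 <= chi sg)%R by apply: chi0; rewrite sgT ltW.
apply: (@le_trans _ _ ((chi_root * sg)%:E * Hy)); last first.
  by rewrite leeDr// lee_fin mulr_ge0// ltW.
have [sT|Ts] := leP s T.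
  apply: (@le_trans _ _ ((ac `^ q^-1 * sg)%:E * Hy)).
    rewrite -EFinM; apply: root_bound => //.
    have sT' : (0 <= s <= T)%R by rewrite sT ltW.
    apply: (@le_trans _ _ (ac * (sg / s) `^ q * chi s)%:E).
      by rewrite lee_fin; apply: chi_inc => //; exact: ltW.
    rewrite EFinM; apply: lee_wpmul2l; first by rewrite lee_fin mulr_ge0 ?powR_ge0// ltW.
    by apply: le_trans FhH; case: (two s sT').
  apply: lee_wpmul2r => //; rewrite lee_fin ler_wpM2r ?(ltW sg0)//.
  by rewrite ler_peMr ?(ltW acq0)// lerDl mulr_ge0 ?powR_ge0// ltW.
have s1 : s%:E <= (ainc_root * T)%:E * Hy.
  suff : (1 `^ q^-1 * s)%:E <= (ainc_root * T)%:E * Hy by rewrite powR1 mul1r.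
  apply: root_bound => //.
  apply: (le_trans phiT); apply: (le_trans (inc _ _ bT (ltW Ts))).
  by apply: lee_wpmul2l => //; rewrite lee_fin mulr_ge0 ?powR_ge0// ltW.
have XT : (X * T <= ac `^ q^-1 * sg * chi T `^ q^-1)%R.
  rewrite -lee_fin [leRHS]EFinM; apply: root_bound => //; first by rewrite lee_fin powR_ge0.
  by rewrite poweR_EFin powRVK// lee_fin; apply: chi_inc.
apply: (@le_trans _ _ (X%:E * ((ainc_root * T)%:E * Hy))).
  by apply: lee_wpmul2l.
rewrite muleA -EFinM; apply: lee_wpmul2r => //; rewrite lee_fin mulrCA.
apply: (@le_trans _ _ (ainc_root * (ac `^ q^-1 * sg * chi T `^ q^-1))%R).
  by apply: ler_wpM2l => //; exact: ltW.
rewrite /chi_root mulrDr mulr1 mulrDl.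
rewrite [leLHS](_ : _ = ac `^ q^-1 * (ainc_root * chi T `^ q^-1) * sg)%R; last by ring.
by rewrite lerDr mulr_ge0// ltW.
Qed.

(** A substitute for Hoelder's inequality: with r = |B|^(-1/q), the pointwise
    bound H <= r + r^(1-q) H^q is averaged over B. *)
Lemma avg_le_root (H : E -> \bar R) (D : R) k : measurable_fun setT H ->
  (forall x, 0 <= H x) -> (0 <= D)%R -> \int[mu]_x H x `^ q <= D%:E ->
  avg H k <= ((1 + D) * ((fine (mu (qball k)))^-1) `^ q^-1)%:E.
Proof.
move=> mH H0 D0 HD; set V := fine _; set r := (_ `^ _)%R.
have V0 : (0 < V)%R by exact: qball_gt0.
have r0 : (0 < r)%R by rewrite powR_gt0// invr_gt0.
have mHq : measurable_fun setT (fun x => H x `^ q).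
  by apply: (measurableT_comp (measurable_poweR _)); exact: mH.
have Hq0 x : 0 <= H x `^ q by exact: poweR_ge0.
apply: (@le_trans _ _ (r%:E + (r `^ (1 - q))%:E * avg (fun x => H x `^ q) k)).
  apply: avg_le_affine; [exact: mH|exact: mHq|exact: H0|exact: Hq0|exact: ltW|exact: powR_ge0|].
  apply: aeW => y _; case HE : (H y) (H0 y) => [w| |] // w0; last first.
    rewrite poweRyr ?gt_eqF// gt0_muley ?addey ?leey// lte_fin powR_gt0//.
  rewrite lee_fin in w0; rewrite poweR_EFin -EFinM -EFinD lee_fin.
  have [wr|rw] := leP w r; first by rewrite ler_wpDr// mulr_ge0// powR_ge0.
  rewrite ler_wpDl ?(ltW r0)// -(mulr_powRB1 w0 q0) mulrCA ler_peMr//.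
  have -> : (1 - q = - (q - 1))%R by lra.
  have rq0 : (0 < r `^ (q - 1))%R := powR_gt0 _ r0.
  rewrite powRN ler_pdivlMl// mulr1.
  by apply: ge0_ler_powR; rewrite ?nnegrE ?(ltW rw) ?(ltW r0)// subr_ge0 ltW.
rewrite mulrDl mul1r EFinD; apply: leeD2l.
have -> : (D * r = r `^ (1 - q) * (V^-1 * D))%R.
  have -> : (V^-1 = r `^ q)%R by rewrite powRVK// invr_ge0 ltW.
  rewrite mulrA -powRD ?subrK; last by apply/implyP => _; rewrite gt_eqF.
  by rewrite powRr1 ?(ltW r0)// mulrC.
rewrite [leRHS]EFinM; apply: lee_wpmul2l; first by rewrite lee_fin powR_ge0.
rewrite EFinM; apply: lee_wpmul2l; first by rewrite lee_fin invr_ge0 ltW.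
apply: le_trans HD; apply: ge0_subset_integral => //.
exact: measurable_qball.
Qed.

Context {F H : E -> \bar R} {D : R} {x : E}.
Context (mF : measurable_fun setT F) (mH : measurable_fun setT H).
Context (F0 : forall y, 0 <= F y) (H0 : forall y, 0 <= H y).
Context (Fout : forall y, ~ Omega y -> F y = 0).
Context (aereg : \forall y \ae mu, Omega y -> regular y).
Context (FH : forall y, Omega y -> phi_ext phi y (F y) + (h y)%:E <= H y `^ q).
Context (D0 : (0 <= D)%R) (HD : \int[mu]_y H y `^ q <= D%:E).
Context (Ox : Omega x) (regx : regular x).
Context (A1x : forall kj : nat * nat,
  mu (qball kj.1) <= 1 -> (2 ^+ kj.2 <= (fine (mu (qball kj.1)))^-1)%R ->
  \forall y \ae mu, (qball kj.1 `&` Omega) x -> (qball kj.1 `&` Omega) y ->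
    forall tau : R, (0 < tau)%R ->
    phi y tau < (2 ^+ kj.2)%:E -> phi x (be * tau)%R < (2 ^+ kj.2)%:E).

Let FH' y : Omega y -> phi_ext phi y (F y) <= H y `^ q.
Proof. by move=> Oy; apply: le_trans (FH y Oy); rewrite leeDl// lee_fin. Qed.

(** The factor by which avg_B F may exceed sg in [avg_estimate_large]. *)
Definition large_factor : R := (1 + 2 * ainc_root * (1 + D))%R.
Let large0 : (0 < large_factor)%R.
Proof. by rewrite ltr_wpDr// !mulr_ge0 ?addr_ge0// ltW. Qed.

(** A large average of H: by [avg_le_root] the level t = 2^j just below
    (A / (1 + D))^q is at most 1/|B|, hence admitted by A1, and sg is taken
    so that phi(x, be sg) reaches t while phi(x, be sg / 2) does not.  Then
    phi(y, sg) >= t for almost all y in B. *)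
Lemma avg_estimate_large k (A : R) : qball k x -> avg H k = A%:E ->
  (1 + D < A)%R ->
  phi_ext phi x ((be / (2 * large_factor))%:E * avg F k) <= (avg H k) `^ q.
Proof.
move=> kx AE DA; set V := fine (mu (@qball R n k)).
have V0 : (0 < V)%R by exact: qball_gt0.
have [be0 be1] := andP be01.
have D10 : (0 < 1 + D)%R by rewrite ltr_wpDr.
pose z := (A / (1 + D))%R.
have z1 : (1 < z)%R by rewrite /z ltr_pdivlMr// mul1r.
have z0 := lt_trans ltr01 z1.
have zqV : (z `^ q <= V^-1)%R.
  rewrite -(powRVK q V^-1)// ?invr_ge0 ?(ltW V0)//.
  apply: ge0_ler_powR; rewrite ?nnegrE ?powR_ge0 ?(ltW q0) ?(ltW z0)//.
  by rewrite /z ler_pdivrMr// mulrC -lee_fin -AE; exact: avg_le_root.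
have zq1 : (1 < z `^ q)%R.
  by have := @gt0_ltr_powR R _ q0 1%R z; rewrite powR1; apply; rewrite ?nnegrE// ltW.
have [j /andP[jz zj]] := dyadic_between 1%R (z `^ q) ltr01 zq1.
rewrite !mul1r in jz zj.
set t : R := (2 ^+ j)%R in jz.
have t1 : (1 <= t)%R by rewrite exprn_ege1// ler1n.
have t0 : (0 < t)%R by exact: lt_le_trans t1.
have k1 : mu (@qball R n k) <= 1.
  rewrite qballE lee_fin -/V -(invrK V) invf_le1 ?invr_gt0//.
  by apply: le_trans zqV; exact: ltW.
have tV : (t <= V^-1)%R by apply: le_trans zqV; exact: ltW.
have [phib _ _ _] := regx.
have phibt : phi x b < t%:E by apply: (lt_le_trans phib); rewrite lee_fin.
have [tau [btau ttau taut]] := level_point x b t Ox b0 phibt.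
have tau0 := lt_trans b0 btau.
pose sg := (tau / be)%R.
have sg0 : (0 < sg)%R by rewrite divr_gt0.
have bsg : (b < sg)%R.
  by apply: (lt_le_trans btau); rewrite ler_pdivlMr// ler_piMr// ltW.
pose t' := (t `^ q^-1)%R.
have t'0 : (0 < t')%R by exact: powR_gt0.
have Fle : avg F k <= sg%:E + (ainc_root * sg / t')%:E * avg H k.
  have K0 : (0 <= ainc_root * sg / t')%R by rewrite ltW// divr_gt0// mulr_gt0.
  apply: avg_le_affine; [exact: mF|exact: mH|exact: F0|exact: H0|exact: ltW|exact: K0|].
  have := A1x (k, j) k1 tV; apply: filterS2 aereg => y regy Hy ky.
  have [Oy|nOy] := pselect (Omega y); last first.
    by rewrite Fout// adde_ge0 ?mule_ge0 ?lee_fin ?(ltW sg0)//.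
  have [_ _ incy _] := regy Oy.
  have tsg : t%:E <= phi y sg.
    rewrite leNgt; apply/negP => /(Hy (conj kx Ox) (conj ky Oy) _ sg0).
    by rewrite /sg mulrC divfK ?gt_eqF// ltNge ttau.
  have := bound_above_level y (F y) (H y) sg t Oy incy bsg (ltW t0) tsg (F0 y) (H0 y) (FH' y
    Oy).
  rewrite -/t' => bnd; rewrite -(@lee_pmul2l _ t'%:E)// ?lte_fin//.
  apply: (le_trans bnd); rewrite [leRHS]ge0_muleDr;
    [|by rewrite lee_fin ltW|by rewrite mule_ge0].
  rewrite EFinM; apply: leeD => //; rewrite muleA -EFinM.
  by have -> : (t' * (ainc_root * sg / t') = ainc_root * sg)%R by rewrite mulrCA divff
    ?mulr1// gt_eqF.
have zt' : (z <= 2 * t')%R.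
  apply: (@ler_powR_root _ q) => //; [exact: ltW|by rewrite mulr_ge0// ltW|].
  rewrite powRM ?(ltW t'0)// powRVK ?(ltW t0)//.
  apply: (le_trans zj); rewrite exprS -/t ler_wpM2r ?(ltW t0)//.
  by rewrite -[leLHS]powRr1//; apply: ler_powR; [rewrite ler1n|exact: ltW].
have {}Fle : avg F k <= (sg * large_factor)%:E.
  apply: (le_trans Fle); rewrite AE -EFinM -EFinD lee_fin /large_factor mulrDr mulr1 lerD2l.
  have -> : (A = z * (1 + D))%R by rewrite /z divfK// gt_eqF.
  have -> : (ainc_root * sg / t' * (z * (1 + D)) = ainc_root * sg * (1 + D) * (z / t'))%R by
    ring.
  have -> : (sg * (2 * ainc_root * (1 + D)) = ainc_root * sg * (1 + D) * 2)%R by ring.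
  apply: ler_wpM2l; last by rewrite ler_pdivrMr.
  by apply: mulr_ge0; [apply: mulr_ge0|]; exact: ltW.
have cF : (be / (2 * large_factor))%:E * avg F k <= (tau / 2)%:E.
  have -> : (tau / 2 = be / (2 * large_factor) * (sg * large_factor))%R by rewrite /sg;
    field; rewrite !gt_eqF.
  rewrite [leRHS]EFinM; apply: lee_wpmul2l => //.
  by rewrite lee_fin divr_ge0// ltW// mulr_gt0.
apply: (@le_trans _ _ (phi_ext phi x (tau / 2)%:E)).
  apply: phi_ext_le => //; rewrite mule_ge0 ?avg_ge0// lee_fin divr_ge0//.
    exact: ltW.
  by rewrite mulr_ge0// ltW.
rewrite /=; apply: (le_trans (ltW taut)); rewrite AE poweR_EFin lee_fin.
apply: (le_trans (ltW jz)); apply: ge0_ler_powR; rewrite ?nnegrE ?(ltW q0) ?(ltW z0)//.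
  by apply: ltW; exact: lt_trans DA.
by rewrite /z ler_pdivrMr// ler_peMr ?lerDl// ltW// (lt_trans _ DA).
Qed.

(** Half the reciprocal of the factor by which avg_B F may exceed T in
    [avg_estimate_small]. *)
Definition small_factor : R := (2 * (1 + ainc_root * (1 + D)))^-1%R.
Let D10 : (0 < 1 + D)%R. Proof. by rewrite ltr_wpDr. Qed.
Let KD1 : (1 < 1 + ainc_root * (1 + D))%R. Proof. by rewrite ltrDl mulr_gt0. Qed.
Let small0 : (0 < small_factor)%R.
Proof. by rewrite invr_gt0 mulr_gt0// (lt_trans ltr01). Qed.
Let small12 : (small_factor <= 2^-1)%R.
Proof. by rewrite lef_pV2 ?posrE ?mulr_gt0 ?(lt_trans ltr01 KD1)// ler_peMr// ltW. Qed.

(** A bounded average of H: the level 1, reached at T, shows that u = avg_B F is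
    bounded, so the small multiple sg of u lies in [0, T]; the level argument for
    chi at sg then gives chi(sg) <= (K A)^q. *)
Lemma avg_estimate_small k (A : R) : avg H k = A%:E -> (A <= 1 + D)%R ->
  phi_ext phi x ((c1 * small_factor)%:E * avg F k) <=
    (chi_root `^ q)%:E * (avg H k) `^ q + (h x)%:E.
Proof.
move=> AE AD.
have A0 : (0 <= A)%R by rewrite -lee_fin -AE avg_ge0.
have [_ _ _ twox] := regx.
have KT0 : (0 <= ainc_root * T)%R by rewrite ltW// mulr_gt0.
have Fle : avg F k <= T%:E + (ainc_root * T)%:E * avg H k.
  apply: avg_le_affine; [exact: mF|exact: mH|exact: F0|exact: H0|exact: ltW|exact: KT0|].
  apply: filterS aereg => y regy ky.
  have [Oy|nOy] := pselect (Omega y); last first.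
    by rewrite Fout// adde_ge0 ?mule_ge0 ?lee_fin ?(ltW T0).
  have [_ phiT incy _] := regy Oy.
  have := bound_above_level y (F y) (H y) T 1 Oy incy bT ler01 phiT (F0 y) (H0 y) (FH' y Oy).
  by rewrite powR1 mul1e mul1r.
have uE : avg F k = (fine (avg F k))%:E.
  rewrite fineK// ge0_fin_numE ?avg_ge0//; apply: (le_lt_trans Fle).
  by rewrite AE -EFinM -EFinD ltry.
set u := fine (avg F k) in uE.
have u0 : (0 <= u)%R by rewrite /u fine_ge0// avg_ge0.
have rhs0 : 0 <= (chi_root `^ q)%:E * (avg H k) `^ q.
  by rewrite mule_ge0 ?poweR_ge0// lee_fin powR_ge0.
rewrite uE -EFinM /= in Fle *.
have [u00|un0] := eqVneq u 0%R.
  by rewrite u00 mulr0 (phi0 wphi)// adde_ge0// lee_fin.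
have {un0}u0 : (0 < u)%R by rewrite lt_neqAle eq_sym un0.
have sg0 : (0 < small_factor * u)%R by rewrite mulr_gt0.
have sgT : (small_factor * u <= T)%R.
  rewrite /small_factor mulrC ler_pdivrMr; last by rewrite mulr_gt0// (lt_trans ltr01).
  apply: (@le_trans _ _ (T * (1 + ainc_root * (1 + D)))%R).
    move: Fle; rewrite AE -EFinM -EFinD lee_fin => /le_trans; apply.
    by rewrite mulrDr mulr1 lerD2l mulrA [(T * ainc_root)%R]mulrC ler_wpM2l.
  by rewrite ler_pM2l// ler_peMl ?ler1n// ltW// (lt_trans ltr01).
have sgT' : (0 <= small_factor * u <= T)%R by rewrite sgT ltW.
have [_ phile] := twox _ sgT'.
rewrite -mulrA; apply: (le_trans phile); apply: leeD => //.
have chisg0 := chi0 _ sgT'.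
have [chi00|chin0] := eqVneq (chi (small_factor * u)%R) 0%R; first by rewrite chi00.
set X : R := (chi (small_factor * u)%R `^ q^-1)%R.
have X0 : (0 < X)%R by rewrite powR_gt0// lt_neqAle eq_sym chin0.
have KX0 : (0 <= chi_root * (small_factor * u) / X)%R by rewrite ltW// divr_gt0// mulr_gt0.
have Fle2 : avg F k <= (small_factor * u)%:E + (chi_root * (small_factor * u) / X)%:E * avg H k.
  apply: avg_le_affine; [exact: mF|exact: mH|exact: F0|exact: H0|exact: ltW|exact: KX0|].
  apply: filterS aereg => y regy ky.
  have [Oy|nOy] := pselect (Omega y); last first.
    by rewrite Fout// adde_ge0 ?mule_ge0 ?lee_fin ?(ltW sg0).
  have bnd := bound_above_chi y (F y) (H y) _ Oy (regy Oy) sg0 sgT (F0 y) (H0 y) (FH y Oy).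
  rewrite -/X in bnd; rewrite -(@lee_pmul2l _ X%:E)// ?lte_fin//.
  apply: (le_trans bnd); rewrite [leRHS]ge0_muleDr;
    [|by rewrite lee_fin ltW|by rewrite mule_ge0].
  rewrite EFinM; apply: leeD => //; rewrite muleA -EFinM.
  by have -> : (X * (chi_root * (small_factor * u) / X) = chi_root * (small_factor * u))%R by
    rewrite mulrCA divff ?mulr1// gt_eqF.
(* divide by [u] and absorb the first term, as [small_factor <= 1/2] *)
have XA : (X <= chi_root * A)%R.
  move: Fle2; rewrite AE uE -EFinM -EFinD lee_fin.
  have -> : (small_factor * u + chi_root * (small_factor * u) / X * A = u * (small_factor +
    chi_root * small_factor * A / X))%R by ring.
  rewrite -[leLHS]mulr1 ler_pM2l// => h1.
  have : (2^-1 <= chi_root * small_factor * A / X)%R by have := small12; lra.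
  rewrite ler_pdivlMr// => h2.
  have h3 : (chi_root * small_factor * A <= chi_root * 2^-1 * A)%R by rewrite ler_wpM2r//
    ler_wpM2l// ltW.
  by lra.
rewrite AE poweR_EFin -EFinM lee_fin -powRM ?(ltW chi_root0)//.
rewrite -(powRVK q (chi _))//; apply: ge0_ler_powR; rewrite ?nnegrE ?powR_ge0 ?(ltW q0)//.
by rewrite mulr_ge0// ltW.
Qed.

Definition key_scale : R := Num.min (be / (2 * large_factor))%R (c1 * small_factor)%R.
Definition key_const : R := (1 + chi_root `^ q)%R.

Lemma key_scale_gt0 : (0 < key_scale)%R.
Proof.
have [be0 _] := andP be01.
by rewrite /key_scale lt_min divr_gt0//= ?mulr_gt0.
Qed.

Lemma key_const_gt0 : (0 < key_const)%R.
Proof. by rewrite ltr_wpDr// powR_ge0. Qed.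

(** The two regimes meet at avg_B H = 1 + D, and an infinite average of H makes the
    right-hand side infinite. *)
Lemma key_estimate k : qball k x ->
  phi_ext phi x (key_scale%:E * avg F k) <=
    key_const%:E * (avg H k) `^ q + (h x)%:E.
Proof.
move=> kx; have s0 := key_scale_gt0.
have F0' := avg_ge0 F k F0; have hx0 : 0 <= (h x)%:E by rewrite lee_fin.
have mono (r : R) : (key_scale <= r)%R ->
    phi_ext phi x (key_scale%:E * avg F k) <= phi_ext phi x (r%:E * avg F k).
  move=> sr; apply: phi_ext_le => //; first by rewrite mule_ge0// lee_fin ltW.
  by apply: lee_wpmul2r.
have AC (c : R) : (c <= key_const)%R -> c%:E * (avg H k) `^ q <= key_const%:E * (avg H k) `^ q.
  by move=> cC; apply: lee_wpmul2r; rewrite ?poweR_ge0.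
case AE : (avg H k) (avg_ge0 H k H0) => [A| |] // A0; last first.
  by rewrite poweRyr ?gt_eqF// gt0_muley ?lte_fin ?key_const_gt0// addye// leey.
rewrite -AE; have [AD|AD] := leP A (1 + D)%R.
  apply: (le_trans (mono (c1 * small_factor)%R _)); first by rewrite ge_min lexx orbT.
  apply: (le_trans (avg_estimate_small k A AE AD)); apply: leeD => //.
  by apply: AC; rewrite lerDr.
apply: (le_trans (mono (be / (2 * large_factor))%R _)); first by rewrite ge_min lexx.
apply: (le_trans (avg_estimate_large k A kx AE AD)).
rewrite -[leLHS]adde0; apply: leeD => //; rewrite -[leLHS]mul1e; apply: AC.
by rewrite lerDl powR_ge0.
Qed.

End key_estimate.

(** * The maximal operator and the modular *)

Section maximal_operator.
Context {R : realType} {n : nat}.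
Local Notation E := (euclid R n).
Local Notation mu := (@lebesgue R n : {measure set E -> \bar R}).
Local Open Scope ereal_scope.
Context {Omega : set E} (mO : measurable Omega).
Implicit Types (f : E -> \bar R).

Definition zero_ext f : E -> \bar R := (fun y => `|f y|) \_ Omega.

Lemma zero_ext_ge0 f y : 0 <= zero_ext f y.
Proof. by rewrite /zero_ext patchE; case: ifP. Qed.

Lemma measurable_zero_ext f : measurable_fun Omega f ->
  measurable_fun setT (zero_ext f).
Proof.
move=> mf; apply/(measurable_restrictT (fun y => `|f y|) mO).
by apply: (measurableT_comp (@abse_measurable R setT)); exact: mf.
Qed.

Lemma maximal_le_qmax f x : measurable_fun Omega f ->
  maximal Omega f x <= (@doubling_const R n)%:E * qmax (zero_ext f) x.
Proof.
move=> mf; apply: ge_ereal_sup => _ [[c r] /= [r0 xr] <-].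
have mF := measurable_zero_ext f mf; have F0 := zero_ext_ge0 f.
have [k sub muk] := eball_sub_qball c r r0.
have V0 := lebesgue_eball_gt0 c r r0.
set V := fine _ in V0 muk *.
have C0 : (0 <= @doubling_const R n)%R by rewrite exprn_ge0// mulr_ge0.
apply: (@le_trans _ _ ((@doubling_const R n)%:E * avg (zero_ext f) k)); last first.
  apply: lee_wpmul2l => //; apply: ereal_sup_ubound; exists k => //; exact: sub.
rewrite integral_mkcondr -/(zero_ext f) lee_pdivrMl// muleA -EFinM.
have muE := qballE (R := R) (n := n) k.
have W0 := @qball_gt0 R n k.
rewrite muE lee_fin in muk; set W := fine _ in muE W0 muk.
apply: (@le_trans _ _ (W%:E * avg (zero_ext f) k)); last first.
  apply: lee_wpmul2r; first exact: avg_ge0.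
  by rewrite lee_fin mulrC.
rewrite /avg muleA -EFinM divff ?gt_eqF// mul1e.
apply: ge0_subset_integral; [exact: measurable_eball|exact: measurable_qball| |by []
  |exact: sub].
exact: measurable_funS mF.
Qed.

(** The superlevel sets are unions of balls, hence relatively open. *)
Lemma measurable_maximal f : measurable_fun Omega (maximal Omega f).
Proof.
move=> mD; apply: (measurability _ (ErealGenOInfty.measurableE R)) => //.
move=> _ [_ [y ->] <-]; apply: measurableI => //.
have -> : maximal Omega f @^-1` `]y%:E, +oo[ =
    \bigcup_(cr in [set cr : E * R | (0 < cr.2)%R /\ y%:E <
      ((fine (mu (eball cr.1 cr.2)))^-1)%:E *
                 \int[mu]_(y in eball cr.1 cr.2 `&` Omega) `|f y|]) eball cr.1 cr.2.
  apply/seteqP; split => x /=.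
    rewrite in_itv/= andbT => /ereal_sup_gtP[_ [cr [cr0 xcr] <-] ycr].
    by exists cr.
  move=> [cr [cr0 ycr] xcr]; rewrite in_itv/= andbT.
  by apply/ereal_sup_gtP; eexists; [exists cr|exact: ycr].
apply: open_measurable_euclid; apply: bigcup_open => cr _; exact: open_eball.
Qed.

Lemma maximal_ge0 f x : 0 <= maximal Omega f x.
Proof.
apply: (@le_trans _ _ (((fine (mu (eball x 1)))^-1)%:E *
                 \int[mu]_(y in eball x 1 `&` Omega) `|f y|)).
  by rewrite mule_ge0 ?integral_ge0// lee_fin invr_ge0 fine_ge0.
apply: ereal_sup_ubound; exists (x, 1%R) => //; split => //=.
exact: eball_center.
Qed.

Lemma maximal_scale f x (l : R) : (0 < l)%R -> measurable_fun Omega f ->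
  maximal Omega f x <= l%:E * maximal Omega (fun y => f y * l^-1%:E) x.
Proof.
move=> l0 mf; apply: ge_ereal_sup => _ [[c r] /= [r0 xr] <-].
rewrite [leRHS]muleC -lee_pdivrMr// -muleA.
apply: ereal_sup_ubound; exists (c, r) => //=; congr (_ * _).
have mB : measurable (eball c r `&` Omega).
  by apply: measurableI => //; exact: measurable_eball.
rewrite -ge0_integralZr; [|exact: mB| |by []|by rewrite lee_fin invr_ge0 ltW]; last first.
  by apply: (measurableT_comp (@abse_measurable R setT)); exact: measurable_funS mf.
apply: eq_integral => y _; rewrite abseM; congr (_ * _).
by rewrite gee0_abs// lee_fin invr_ge0 ltW.
Qed.

Context {phi : E -> R -> \bar R}.
Context (wphi : weak_Phi Omega phi).

Lemma measurable_phi_ext f : measurable_fun Omega f -> (forall x, 0 <= f x) ->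
  measurable_fun Omega (fun x => phi_ext phi x (f x)).
Proof.
move=> mf f0; have [_ mphi _ _ _] := wphi.
apply: (@eq_measurable_fun _ _ _ _ _
  (fun x => if f x < +oo then phi x `|fine (f x)|%R else +oo)).
  move=> x _; case: (f x) (f0 x) => [r| |]//=; rewrite ?ltxx// ltry.
  by rewrite lee_fin => r0; rewrite ger0_norm.
apply: measurable_fun_if; [exact: mO| | |exact: measurable_cst].
  by apply: measurable_fun_lte; [exact: mf|exact: measurable_cst].
apply: (@measurable_funS _ _ _ _ Omega); [exact: mO|by move=> x []|].
apply: mphi; apply: (measurableT_comp (@fine_measurable R setT measurableT)); exact: mf.
Qed.

(** Halving the argument makes room for a ball that nearly attains the
    supremum, in place of left-continuity of phi(x, .).
    Where Mf is infinite, unboundedness of phi(x, .) forces B to be infinite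
    as well. *)
Lemma phi_maximal_le f x (s : R) (B : \bar R) : Omega x -> measurable_fun Omega f ->
  (0 < s)%R -> (forall k, qball k x -> phi_ext phi x (s%:E * avg (zero_ext f) k) <= B) ->
  phi_ext phi x ((s / 2 / @doubling_const R n)%:E * maximal Omega f x) <= B.
Proof.
move=> Ox mf s0 HB.
have F0 := zero_ext_ge0 f.
have C0 : (0 < @doubling_const R n)%R by rewrite exprn_gt0// mulr_gt0.
set C := doubling_const in C0 *.
have step (v : R) : (0 <= v)%R -> v%:E < s%:E * qmax (zero_ext f) x -> phi x v <= B.
  move=> v0; rewrite muleC -lte_pdivrMr// => /ereal_sup_gtP[_ [k kx <-]].
  rewrite lte_pdivrMr// muleC => vk; apply: le_trans (HB k kx).
  rewrite -[phi x v]/(phi_ext phi x v%:E).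
  by apply: (phi_ext_le wphi) => //; exact: ltW.
have B0 : 0 <= B.
  have [k xk _] := eball_sub_qball x 1 ltr01.
  apply: le_trans (HB k _); last by apply: xk; exact: eball_center.
  apply: (phi_ext_ge0 wphi) => //; rewrite mule_ge0 ?lee_fin ?(ltW s0)//.
  exact: avg_ge0.
have Mq : maximal Omega f x <= C%:E * qmax (zero_ext f) x by exact: maximal_le_qmax.
case mE : (maximal Omega f x) (maximal_ge0 f x) => [m| |] // m0; last first.
  rewrite gt0_muley ?lte_fin ?divr_gt0//=.
  rewrite leye_eq; apply/eqP/eq_infty => A.
  have [v v0 Av] := phi_unbounded wphi x A Ox.
  apply: (le_trans (ltW Av)); apply: step; first exact: ltW.
  have -> : qmax (zero_ext f) x = +oo.
    apply/eqP; rewrite -leye_eq leNgt; apply/negP => qfin.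
    move: Mq; rewrite mE leye_eq => /eqP Cq.
    have : C%:E * qmax (zero_ext f) x < +oo by rewrite lte_mul_pinfty// lee_fin ltW.
    by rewrite Cq ltxx.
  by rewrite gt0_muley ?ltry// lte_fin.
rewrite lee_fin in m0.
rewrite /= ; move: m0; rewrite le_eqVlt => /predU1P[<-|m0].
  by rewrite mulr0 (phi0 wphi).
apply: step; first by rewrite !mulr_ge0 ?invr_ge0// ltW.
apply: (@lt_le_trans _ _ (s%:E * (m / C)%:E)).
  rewrite -EFinM lte_fin [ltLHS](_ : _ = s * (m / C) / 2)%R; last by ring.
  have : (0 < s * (m / C))%R by rewrite mulr_gt0// divr_gt0.
  by move: (s * (m / C))%R => w; lra.
apply: lee_wpmul2l; first by rewrite lee_fin ltW.
by rewrite mulrC EFinM lee_pdivrMl// -mE.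
Qed.

End maximal_operator.

Section modular_bound.
Context {R : realType} {n : nat}.
Local Notation E := (euclid R n).
Local Notation mu := (@lebesgue R n : {measure set E -> \bar R}).
Local Open Scope ereal_scope.
Context {Omega : set E} {phi : E -> R -> \bar R}.
Context (mO : measurable Omega) (wphi : weak_Phi Omega phi).

(** Small multiples of a function have small modular. *)
Lemma modular_scale : exists2 L : R, (1 <= L)%R &
  forall (l : R) (g : E -> \bar R), (0 < l)%R -> (l <= 1)%R ->
    measurable_fun Omega g -> (forall x, 0 <= g x) ->
    \int[mu]_(x in Omega) phi_ext phi x (l%:E * g x) <=
      (L * l)%:E * \int[mu]_(x in Omega) phi_ext phi x (g x).
Proof.
have [L L1 HL] := phi_scale wphi; exists L => // l g l0 l1 mg g0.
have L0 := lt_le_trans ltr01 L1.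
have Ll0 : (0 < L * l)%R by rewrite mulr_gt0.
have mp := measurable_phi_ext mO wphi g mg g0.
have lg0 x : 0 <= l%:E * g x by rewrite mule_ge0// lee_fin ltW.
rewrite -ge0_integralZl; [|exact: mO|exact: mp| |by rewrite lee_fin ltW]; last first.
  by move=> x Ox; exact: (phi_ext_ge0 wphi).
apply: ge0_le_integral; [exact: mO| | | |].
- by move=> x Ox; exact: (phi_ext_ge0 wphi).
- by apply: (measurable_phi_ext mO wphi); [exact: measurable_funeM|exact: lg0].
- exact: measurable_funeM.
move=> x Ox; case: (g x) (g0 x) => [r| |]//= r0; last first.
  by rewrite gt0_muley ?lte_fin//= gt0_muley ?lte_fin.
exact: HL.
Qed.

(** Integrating the key estimate with the maximal theorem gives some finite
    bound N for the modular of s1 Mf; the scalar l lowers it to 1. *)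
Lemma modular_bound (G : set E) : A0 Omega phi -> A1 Omega phi -> A2 Omega phi ->
  aInc_infty Omega phi -> measurable G -> mu G < +oo ->
  (exists2 p : R, (1 < p)%R & aInc phi p (Omega `\` G) `]0%R, +oo[) ->
  exists2 c : R, (0 < c)%R & forall f, measurable_fun Omega f ->
    \int[mu]_(x in Omega) phi_ext phi x `|f x| <= 1 ->
    \int[mu]_(x in Omega) phi_ext phi x (c%:E * maximal Omega f x) <= 1.
Proof.
move=> hA0 hA1 hA2 [p1 [t0 [p11 t00 hinf]]] mG Gfin [p2 p21 hG].
have [b [T [b0 bT Hb]]] := A0_bounds wphi hA0.
have [be be01 HA1] := A1_uniform wphi hA1.
pose q := Num.min p1 p2.
have q1 : (1 < q)%R by rewrite lt_min p11.
have q0 := lt_trans ltr01 q1.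
have sub1 t : (t0 < t)%R -> `[t0, +oo[%classic t.
  by move=> ht; rewrite /= in_itv/= andbT ltW.
have [a1' a1'1 Hinf] := ae_ainc wphi p1 Omega _ t0 (ltW t00)
  (ltW (lt_trans ltr01 p11)) sub1 (@subset_refl _ _) hinf.
have sub2 (t : R) : (0 < t)%R -> `]0%R, +oo[%classic t.
  by move=> ht; rewrite /= in_itv/= andbT.
have [aG aG1 HG] := ae_ainc wphi p2 (Omega `\` G) _ 0%R (lexx 0%R)
  (ltW (lt_trans ltr01 p21)) sub2 (@subDsetl _ _ _) hG.
pose a := (a1' * ((t0 + 1 + b) / b) `^ q)%R.
have a1 : (1 <= a)%R.
  apply: mulr_ege1 => //; rewrite -[leLHS](powRr0 ((t0 + 1 + b) / b)%R).
  apply: ler_powR; last exact: ltW.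
  by rewrite ler_pdivlMr// mul1r lerDr addr_ge0// ltW.
have Hq : \forall x \ae mu, Omega x -> ainc (phi x) q a b.
  apply: filterS Hinf => x Hx Ox.
  apply: ainc_extend => //; [exact: ltW|exact: ltW|by move=> t; exact: (phi_ge0 wphi)|
    by move=> t s; exact: (phi_le wphi)|].
  apply: (@ainc_exponent _ _ p1) => //;
    [exact: ltW|exact: (le_trans ler01)|by rewrite ge_min lexx|
    by move=> t; exact: (phi_ge0 wphi)|exact: Hx].
have HGq : exists2 a, (1 <= a)%R & \forall x \ae mu, (Omega `\` G) x -> ainc (phi x) q a 0.
  exists aG => //; apply: filterS HG => x Hx OGx.
  have Ox : Omega x by case: OGx.
  apply: (@ainc_exponent _ _ p2) => //; [exact: (le_trans ler01)|by rewrite ge_min lexx orbT|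
    by move=> t; exact: (phi_ge0 wphi)|exact: Hx].
have Hb1 : \forall x \ae mu, Omega x -> phi x b < 1.
  by apply: filterS Hb => x Hx /Hx[].
have [chi [h [c1 [ac [[c10 _ ac1] [mh h0 hfin] [chi0 chi_inc] two]]]]] :=
  A2_two_sided wphi G q T b mO q1 b0 bT hA2 mG Gfin Hb1 HGq.
have aereg : \forall y \ae mu, Omega y -> @regular _ _ phi q a b T c1 chi h y.
  apply: filterS3 Hb Hq two => y H1 H2 H4 Oy.
  by have [] := H1 Oy; split; [| |exact: H2|exact: H4].
have ih0 : 0 <= \int[mu]_(x in Omega) (h x)%:E.
  by apply: integral_ge0 => x _; rewrite lee_fin.
have ihE : \int[mu]_(x in Omega) (h x)%:E = (fine (\int[mu]_(x in Omega) (h x)%:E))%:E.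
  by rewrite fineK// ge0_fin_numE.
set Ih := fine _ in ihE.
have Ih0 : (0 <= Ih)%R by rewrite /Ih fine_ge0.
pose D : R := (1 + Ih)%R.
have D0 : (0 <= D)%R by rewrite addr_ge0.
have [C1 C10 Hstrong] := @qmax_strong R n q q1.
set s := @key_scale R q a c1 be D.
have s0 : (0 < s)%R by exact: key_scale_gt0.
set C := @key_const R q a T ac chi.
have C0 : (0 < C)%R by exact: key_const_gt0.
pose dbl := @doubling_const R n.
have dbl0 : (0 < dbl)%R by rewrite exprn_gt0// mulr_gt0.
pose s1 := (s / 2 / dbl)%R.
have s10 : (0 < s1)%R by rewrite !divr_gt0.
pose N : R := (C * (C1 * D) + Ih)%R.
have N0 : (0 <= N)%R by rewrite addr_ge0// !mulr_ge0// ltW.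
have HN f : measurable_fun Omega f -> \int[mu]_(x in Omega) phi_ext phi x `|f x| <= 1 ->
    \int[mu]_(x in Omega) phi_ext phi x (s1%:E * maximal Omega f x) <= N%:E.
  move=> mf f1.
  have maf : measurable_fun Omega (fun x => `|f x|).
    by apply: (measurableT_comp (@abse_measurable R setT)); exact: mf.
  have mpf : measurable_fun Omega (fun x => phi_ext phi x `|f x|).
    by apply: (measurable_phi_ext mO wphi); [exact: maf|by []].
  pose g y := phi_ext phi y `|f y| + (h y)%:E.
  have mg : measurable_fun Omega g.
    by apply: emeasurable_funD; [exact: mpf|exact/measurable_EFinP].
  have g0 y : Omega y -> 0 <= g y.
    by move=> Oy; rewrite adde_ge0 ?lee_fin//; apply: (phi_ext_ge0 wphi).
  pose H : E -> \bar R := (fun y => g y `^ q^-1) \_ Omega.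
  have mH : measurable_fun setT H.
    apply/(measurable_restrictT (fun y => g y `^ q^-1) mO).
    by apply: (measurableT_comp (measurable_poweR _)); exact: mg.
  have H0 y : 0 <= H y by rewrite /H patchE; case: ifP => // _; exact: poweR_ge0.
  have HqE y : H y `^ q = (g \_ Omega) y.
    rewrite /H !patchE; case: ifPn => [|_]; last by rewrite poweR0r// gt_eqF.
    by rewrite inE => Oy; rewrite -poweRrM mulVf ?gt_eqF// poweRe1// g0.
  have HD : \int[mu]_y H y `^ q <= D%:E.
    rewrite (eq_integral (g \_ Omega)); last by move=> y _; exact: HqE.
    rewrite -integral_mkcond ge0_integralD; [|exact: mO| |exact: mpf| |exact/measurable_EFinP].
    - by rewrite ihE /D EFinD; apply: leeD.
    - by move=> x Ox; apply: (phi_ext_ge0 wphi).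
    - by move=> x _; rewrite lee_fin.
  have mF := measurable_zero_ext mO f mf.
  have Fout y : ~ Omega y -> @zero_ext _ _ Omega f y = 0.
    by move=> nOy; rewrite /zero_ext patchE memNset.
  have FH y : Omega y -> phi_ext phi y (@zero_ext _ _ Omega f y) + (h y)%:E <= H y `^ q.
    by move=> Oy; rewrite HqE /zero_ext !patchE mem_set.
  have mqH : measurable_fun setT (fun x => qmax H x `^ q).
    by apply: (measurableT_comp (measurable_poweR _)); exact: measurable_qmax.
  have qH0 x : 0 <= qmax H x `^ q by exact: poweR_ge0.
  have mM : measurable_fun Omega (fun x => s1%:E * maximal Omega f x).
    by apply: measurable_funeM; exact: measurable_maximal.
  have M0 x : 0 <= s1%:E * maximal Omega f x.
    by rewrite mule_ge0 ?maximal_ge0// lee_fin ltW.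
  have mCq : measurable_fun Omega (fun x => C%:E * qmax H x `^ q).
    by apply: measurable_funeM; exact: measurable_funS mqH.
  apply: (@le_trans _ _ (\int[mu]_(x in Omega) (C%:E * qmax H x `^ q + (h x)%:E))).
    apply: ae_ge0_le_integral; [exact: mO| | | | |].
    - by move=> x Ox; apply: (phi_ext_ge0 wphi).
    - exact: (measurable_phi_ext mO wphi).
    - by move=> x _; rewrite adde_ge0 ?lee_fin// mule_ge0// lee_fin ltW.
    - by apply: emeasurable_funD; [exact: mCq|exact/measurable_EFinP].
    apply: filterS2 (aereg) HA1 => x regx A1x Ox.
    apply: (phi_maximal_le mO wphi) => // k kx.
    apply: (le_trans (key_estimate wphi q1 a1 b0 bT c10 ac1 be01 h0 chi0 chi_inc mF mH
      (zero_ext_ge0 f) H0 Fout aereg FH D0 HD Ox (regx Ox) A1x k kx)).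
    apply: leeD => //; apply: lee_wpmul2l; first by rewrite lee_fin ltW.
    apply: gt0_ler_poweR; first exact: ltW.
    - by rewrite in_itv/= avg_ge0//= leey.
    - by rewrite in_itv/= qmax_ge0//= leey.
    - by apply: ereal_sup_ubound; exists k.
  rewrite ge0_integralD; [|exact: mO| |exact: mCq| |exact/measurable_EFinP].
  - rewrite /N [leRHS]EFinD ihE; apply: leeD => //.
    rewrite ge0_integralZl; [|exact: mO|exact: measurable_funS mqH|by []
      |by rewrite lee_fin ltW].
    rewrite [leRHS]EFinM; apply: lee_wpmul2l; first by rewrite lee_fin ltW.
    apply: (@le_trans _ _ (\int[mu]_x qmax H x `^ q)).
      by apply: ge0_subset_integral; [exact: mO|exact: measurableT|exact: mqH|by []|].
    apply: (le_trans (Hstrong H mH H0)); rewrite [leRHS]EFinM.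
    by apply: lee_wpmul2l; rewrite ?lee_fin.
  - by move=> x _; rewrite mule_ge0// lee_fin ltW.
  - by move=> x _; rewrite lee_fin.
have [L L1 Hscale] := modular_scale.
have L0 := lt_le_trans ltr01 L1.
pose l := (L * (N + 1))^-1%R.
have N10 : (0 < N + 1)%R by rewrite ltr_wpDl.
have l0 : (0 < l)%R by rewrite invr_gt0 mulr_gt0.
have l1 : (l <= 1)%R by rewrite invf_le1 ?mulr_gt0// mulr_ege1// lerDr.
exists (l * s1)%R; first by rewrite mulr_gt0.
move=> f mf f1.
under eq_integral do rewrite EFinM -muleA.
apply: (le_trans (Hscale l _ l0 l1 _ _)).
- by apply: measurable_funeM; exact: measurable_maximal.
- by move=> x; rewrite mule_ge0 ?maximal_ge0// lee_fin ltW.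
apply: (@le_trans _ _ ((L * l)%:E * N%:E)).
  by apply: lee_wpmul2l; [rewrite lee_fin mulr_ge0// ltW|exact: HN].
rewrite -EFinM lee_fin /l invfM mulrA divff ?gt_eqF// mul1r mulrC ler_pdivrMr// mul1r.
by rewrite lerDl.
Qed.

End modular_bound.

Theorem theorem3p1 (R : realType) (n : nat) (Omega : set (euclid R n))
  (phi : euclid R n -> R -> \bar R) :
  open Omega ->
  weak_Phi Omega phi ->
  A0 Omega phi -> A1 Omega phi -> A2 Omega phi -> aInc_infty Omega phi ->
  (exists G : set (euclid R n),
    [/\ measurable G, G `<=` Omega, (0 <= lebesgue G < +oo)%E &
        exists2 p : R, 1 < p & aInc phi p (Omega `\` G) `]0, +oo[]) ->
  exists K : R, forall f : euclid R n -> \bar R, Lphi Omega phi f ->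
    Lphi Omega phi (maximal Omega f) /\
    (Lphi_norm Omega phi (maximal Omega f) <= K%:E * Lphi_norm Omega phi f)%E.
Proof.
move=> oO wphi hA0 hA1 hA2 hinf [G [mG _ /andP[_ Gfin] hG]].
have mO := open_measurable_euclid Omega oO.
have [c c0 Hc] := modular_bound mO wphi G hA0 hA1 hA2 hinf mG Gfin hG.
have step f (l : R) : measurable_fun Omega f -> 0 < l ->
    (\int[@lebesgue R n]_(x in Omega) phi_ext phi x (`|f x| * l^-1%:E) <= 1)%E ->
    (\int[@lebesgue R n]_(x in Omega) phi_ext phi x (`|maximal Omega f x
      | * (c^-1 * l)^-1%:E) <= 1)%E.
  move=> mf l0 fl.
  have l'0 : 0 < l^-1 by rewrite invr_gt0.
  pose f' y := (f y * l^-1%:E)%E.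
  have mf' : measurable_fun Omega f'.
    rewrite /f'; under eq_fun do rewrite muleC; exact: measurable_funeM.
  have f'1 : (\int[@lebesgue R n]_(x in Omega) phi_ext phi x `|f' x| <= 1)%E.
    apply: le_trans fl; rewrite le_eqVlt; apply/orP; left; apply/eqP.
    apply: eq_integral => x _; congr (phi_ext phi x _).
    by rewrite /f' abseM [X in (_ * X)%E]gee0_abs// lee_fin ltW.
  have cl0 : 0 <= (c^-1 * l)^-1 by rewrite invr_ge0 mulr_ge0 ?invr_ge0// ltW.
  have mMf := @measurable_maximal R n Omega.
  have M0 := @maximal_ge0 R n Omega.
  apply: le_trans (Hc f' mf' f'1); apply: ge0_le_integral; [exact: mO| | | |].
  - by move=> x Ox; apply: (phi_ext_ge0 wphi) => //; rewrite mule_ge0.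
  - apply: (measurable_phi_ext mO wphi); last by move=> x; rewrite mule_ge0.
    under eq_fun do rewrite muleC; apply: measurable_funeM.
    by apply: (measurableT_comp (@abse_measurable R setT)); exact: mMf.
  - apply: (measurable_phi_ext mO wphi); last by move=> x; rewrite mule_ge0 ?lee_fin ?(ltW c0).
    by apply: measurable_funeM; exact: mMf.
  move=> x Ox; apply: (phi_ext_le wphi) => //; first by rewrite mule_ge0.
  rewrite gee0_abs// invfM invrK EFinM muleA [leRHS]muleC.
  rewrite muleAC; apply: lee_wpmul2r; first by rewrite lee_fin ltW.
  by rewrite lee_pdivrMr// muleC; exact: (maximal_scale mO).
have normS f (l : R) : measurable_fun Omega f -> 0 < l ->
    (\int[@lebesgue R n]_(x in Omega) phi_ext phi x (`|f x| * l^-1%:E) <= 1)%E ->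
    (Lphi_norm Omega phi (maximal Omega f) <= (c^-1 * l)%:E)%E.
  move=> mf l0 fl; apply: ereal_inf_lbound; exists (c^-1 * l) => //; split.
    by rewrite mulr_gt0// invr_gt0.
  exact: step.
exists c^-1 => f [mf [l l0 fl]].
have maf : measurable_fun Omega (fun x => `|f x|%E).
  by apply: (measurableT_comp (@abse_measurable R setT)); exact: mf.
split.
  split; first exact: measurable_maximal.
  have [L L1 Hscale] := modular_scale mO wphi.
  have L0 := lt_le_trans ltr01 L1.
  set I := (\int[_]_(x in Omega) _)%E in fl.
  have I0 : (0 <= I)%E.
    apply: integral_ge0 => x Ox; apply: (phi_ext_ge0 wphi) => //.
    by rewrite mule_ge0// lee_fin ltW.
  have IE : I = (fine I)%:E by rewrite fineK// ge0_fin_numE.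
  have fI0 : 0 <= fine I by rewrite fine_ge0.
  pose k := (L * (fine I + 1))^-1.
  have I10 : 0 < fine I + 1 by rewrite ltr_wpDl.
  have k0 : 0 < k by rewrite invr_gt0 mulr_gt0.
  have k1 : k <= 1 by rewrite invf_le1 ?mulr_gt0// mulr_ege1// lerDr.
  pose m := (k * l)^-1.
  have m0 : 0 < m by rewrite invr_gt0 mulr_gt0.
  have fm : (\int[@lebesgue R n]_(x in Omega) phi_ext phi x (`|f x| * m^-1%:E) <= 1)%E.
    rewrite /m invrK; under eq_integral do rewrite muleC EFinM -muleA.
    apply: (le_trans (Hscale k _ k0 k1 _ _)).
    - exact: measurable_funeM.
    - by move=> x; rewrite mule_ge0// lee_fin ltW.
    rewrite -/I IE -EFinM lee_fin /k invfM mulrA divff ?gt_eqF// mul1r mulrC ler_pdivrMr//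
      mul1r.
    by rewrite lerDl.
  exists (c^-1 * m)^-1; first by rewrite invr_gt0 mulr_gt0// invr_gt0.
  under eq_integral do rewrite muleC.
  by apply: le_lt_trans (step f m mf m0 fm) _; rewrite ltry.
rewrite muleC -lee_pdivrMr ?invr_gt0//.
apply: le_ereal_inf_tmp => _ [m [m0 fm] <-].
rewrite lee_pdivrMr ?invr_gt0// -EFinM mulrC.
exact: normS.
Qed.
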